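(* Let $r,n,q,k\ge1$ be natural numbers. Then there exist rational numbers $l_i,c_j$ (depending on $n,r,k$, and $q$) such that $$\int_{0}^{1}\frac{x^{2n-1}\ln^{q}(x)}{(1+x^{2})^{r}}\,dx=l_{0}\ln2+\sum_{i=1}^{q}l_{i}\zeta(i+1)+l_{q+1},$$ $$\int_{0}^{1}\frac{x^{2n}\ln^{2k-1}(x)}{(1+x^{2})^{r}}\,dx=l_{0}G+\sum_{i=1}^{k}l_{i}\pi^{2i-1}+\sum_{j=2}^{k}c_{j}\left(\psi^{(2j-1)}\Big(\frac{1}{4}\Big)-\psi^{(2j-1)}\Big(\frac{3}{4}\Big)\right)+l_{k+1},$$ $$\int_{0}^{1}\frac{x^{2n}\ln^{2k}(x)}{(1+x^{2})^{r}}\,dx=l_{0}G+\sum_{i=1}^{k+1}l_{i}\pi^{2i-1}+\sum_{j=2}^{k}c_{j}\left(\psi^{(2j-1)}\Big(\frac{1}{4}\Big)-\psi^{(2j-1)}\Big(\frac{3}{4}\Big)\right)+l_{k+2}.$$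
   Context: $G$ is Catalan's constant, $\zeta$ the Riemann zeta function, and $\psi^{(m)}$ the polygamma function (the $m$-th derivative of $\psi^{(0)}=\Gamma'/\Gamma$). *)

(* Defs.v *)
From Stdlib Require Export Reals QArith Qreals.
From Coquelicot Require Export Coquelicot.
Open Scope R_scope.

Definition catalan : R :=
  Series (fun n : nat => (-1) ^ n / INR (2 * n + 1) ^ 2).

(* The Dirichlet series, which represents the Riemann zeta function for real
   [s > 1]; for [s <= 1] the value is meaningless (no analytic continuation). *)
Definition zeta (s : R) : R :=
  Series (fun n : nat => / Rpower (INR (n + 1)) s).

(* Euler's integral over (0, +oo), improper at both ends; meaningful for
   [x > 0]. *)
Definition Gamma (x : R) : R :=
  RInt_gen (fun t : R => Rpower t (x - 1) * exp (- t))
           (at_right 0) (Rbar_locally p_infty).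

Definition digamma (x : R) : R := Derive Gamma x / Gamma x.

Definition polygamma (m : nat) (x : R) : R := Derive_n digamma m x.

(* Main.v *)
Require Import Defs.
From Stdlib Require Import Reals QArith Qreals Lra Lia Factorial.
From Coquelicot Require Import Coquelicot.
Open Scope R_scope.

(** Let I(m,p,r) be the integral of [x^m ln^p x / (1+x^2)^r] over [0,1], [m >= 1].  Integrating
    the derivative of [x^(m+1) ln^p x / (1+x^2)^r] expresses I(m,p,r+1) through I(m,p,r),
    I(m,p-1,r) and a rational, and [x^2 = (1+x^2) - 1] lowers [m] by 2 when [r = 1]; so only
    I(1,p,1) and I(2,p,1) matter.  As I(m,p,1) - I(m+4,p,1) is a difference of two moments of
    [ln^p], telescoping gives, for [p >= 1], I(m,p,1) as a rational multiple of the difference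
    of the Hurwitz zeta values at [(m+1)/4] and [(m+3)/4] of order [s = p+1].

    For [m = 1] these points are 1/2 and 1, and the duplication formula leaves zeta at [s].

    For [m = 2] they are 3/4 and 5/4, and the difference is Dirichlet's beta at [s] up to
    rationals.  If [s] is even, beta is Catalan's constant or a difference of polygamma values:
    convexity in the form [Gamma (s+l) <= s^l Gamma s] and [Gamma (s+1) = s Gamma s] give
    Euler's series for [ln Gamma], which is differentiated termwise.  If [s] is odd,
    differentiate [hurwitz 2 y + hurwitz 2 (1-y) = (PI / sin (PI y))^2] and put [y = 1/4]: the
    right side becomes [PI^s] times a rational polynomial in [cot (PI/4) = 1].  That identity
    holds because the difference [g] of its two sides is bounded on (0,1) and satisfies
    [g (y/2) + g ((y+1)/2) = 4 g y], which forces [g = 0]. *)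

(* Coquelicot leaves equations between reals in the carrier of an algebraic structure on [R],
   where [ring], [field] and [rewrite] do not recognise them. *)
Ltac equation_in_R := match goal with |- @eq _ ?x ?y => change (@eq R x y) end.

(** * Series and the Hurwitz zeta function *)

Lemma is_lim_seq_inv_shift (y : R) : is_lim_seq (fun k => / (y + INR k)) 0.
Proof.
  change (Finite 0) with (Rbar_inv p_infty).
  apply is_lim_seq_inv; [|discriminate].
  eapply is_lim_seq_plus; [apply is_lim_seq_const|apply is_lim_seq_INR|reflexivity].
Qed.

Lemma is_series_telescope (u : nat -> R) (l : R) :
  is_lim_seq u l -> is_series (fun k => u k - u (S k)) (u 0%nat - l).
Proof.
  intros Hu.
  change (is_lim_seq (sum_n (fun k => u k - u (S k))) (u 0%nat - l)).
  apply is_lim_seq_ext with (u := fun n => u 0%nat - u (S n)).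
  - intros n; induction n as [|n IH]; [now rewrite sum_O|].
    rewrite sum_Sn, <- IH. unfold plus; simpl; ring.
  - apply is_lim_seq_minus'; [apply is_lim_seq_const|].
    now apply is_lim_seq_incr_1 in Hu.
Qed.

Lemma is_series_even_odd (a : nat -> R) (x y : R) :
  is_series (fun n => a (2 * n)%nat) x -> is_series (fun n => a (2 * n + 1)%nat) y ->
  is_series a (x + y).
Proof.
  assert (pseries_at_1 : forall (b : nat -> R) (l : R),
    is_pseries b 1 l <-> is_series b l).
  { intros b l; rewrite is_pseries_R.
    split; apply is_series_ext; intros n; equation_in_R; rewrite pow1; ring. }
  intros Hx Hy; apply pseries_at_1.
  rewrite <- (Rmult_1_l y).
  apply is_pseries_odd_even; rewrite pow1; now apply pseries_at_1.
Qed.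

Lemma ex_series_Rabs_le (a b : nat -> R) :
  (forall n, Rabs (a n) <= b n) -> ex_series b -> ex_series a.
Proof. exact (@ex_series_le R_AbsRing R_CompleteNormedModule a b). Qed.

Lemma Rabs_is_series_le (a b : nat -> R) (x y : R) :
  (forall n, Rabs (a n) <= b n) -> is_series a x -> is_series b y -> Rabs x <= y.
Proof.
  intros Hab Ha Hb.
  assert (Habs : ex_series (fun n => Rabs (a n))).
  { apply (ex_series_Rabs_le _ b); [|now exists y].
    intros n; now rewrite Rabs_Rabsolu. }
  rewrite <- (is_series_unique _ _ Ha), <- (is_series_unique _ _ Hb).
  apply Rle_trans with (1 := Series_Rabs a Habs).
  apply Series_le; [|now exists y].
  intros n; split; [apply Rabs_pos|apply Hab].
Qed.

Lemma inv_pow_div (x c : R) (s : nat) : / (x / c) ^ s = c ^ s * / x ^ s.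
Proof. unfold Rdiv; rewrite Rpow_mult_distr, pow_inv, Rinv_mult, Rinv_inv; ring. Qed.

Lemma inv_pow_pos (x : R) (s : nat) : 0 < x -> 0 < / x ^ s.
Proof. intros Hx; now apply Rinv_0_lt_compat, pow_lt. Qed.

Lemma inv_pow_le (x y : R) (s : nat) : 0 < x <= y -> / y ^ s <= / x ^ s.
Proof. intros Hxy; apply Rinv_le_contravar; [now apply pow_lt|apply pow_incr; lra]. Qed.

Lemma ex_series_inv_sqr_shift (y : R) : 0 < y -> ex_series (fun k => / (y + INR k) ^ 2).
Proof.
  intros Hy; apply ex_series_incr_1.
  apply (ex_series_Rabs_le _ (fun k => / (y + INR k) - / (y + INR (S k)))).
  - intros k; assert (Hk := pos_INR k); rewrite S_INR.
    rewrite Rabs_pos_eq by (apply Rlt_le, inv_pow_pos; lra).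
    apply Rle_trans with (/ ((y + INR k) * (y + (INR k + 1)))); [|right; field; lra].
    apply Rinv_le_contravar; nra.
  - eexists; apply (is_series_telescope (fun k => / (y + INR k))), is_lim_seq_inv_shift.
Qed.

Lemma ex_series_inv_pow_shift (s : nat) (y : R) :
  (2 <= s)%nat -> 0 < y -> ex_series (fun k => / (y + INR k) ^ s).
Proof.
  intros Hs Hy; replace s with (s - 2 + 2)%nat by lia.
  apply (ex_series_Rabs_le _ (fun k => / y ^ (s - 2) * / (y + INR k) ^ 2)).
  - intros k; assert (Hk := pos_INR k).
    rewrite Rabs_pos_eq by (apply Rlt_le, inv_pow_pos; lra).
    rewrite pow_add, Rinv_mult.
    apply Rmult_le_compat_r; [apply Rlt_le, inv_pow_pos|apply inv_pow_le]; lra.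
  - now apply (ex_series_scal (/ y ^ (s - 2)) (fun k => / (y + INR k) ^ 2)),
      ex_series_inv_sqr_shift.
Qed.

Definition hurwitz (s : nat) (y : R) : R := Series (fun k => / (y + INR k) ^ s).

Lemma is_series_hurwitz (s : nat) (y : R) :
  (2 <= s)%nat -> 0 < y -> is_series (fun k => / (y + INR k) ^ s) (hurwitz s y).
Proof. intros Hs Hy; now apply Series_correct, ex_series_inv_pow_shift. Qed.

Lemma zeta_hurwitz (s : nat) : zeta (INR s) = hurwitz s 1.
Proof.
  apply Series_ext; intros n.
  rewrite Rpower_pow by (apply lt_0_INR; lia).
  rewrite plus_INR; simpl (INR 1); now rewrite Rplus_comm.
Qed.

Lemma hurwitz_succ (s : nat) (y : R) :
  (2 <= s)%nat -> 0 < y -> hurwitz s y = / y ^ s + hurwitz s (y + 1).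
Proof.
  intros Hs Hy; unfold hurwitz.
  rewrite Series_incr_1 by now apply ex_series_inv_pow_shift.
  simpl (INR 0); rewrite Rplus_0_r; f_equal.
  apply Series_ext; intros k; rewrite S_INR.
  now replace (y + 1 + INR k) with (y + (INR k + 1)) by ring.
Qed.

Lemma hurwitz_nonneg (s : nat) (y : R) : (2 <= s)%nat -> 0 < y -> 0 <= hurwitz s y.
Proof.
  intros Hs Hy; apply Rle_trans with (1 := Rabs_pos (hurwitz s y)).
  assert (Hsum := is_series_hurwitz s y Hs Hy).
  apply Rabs_is_series_le with (2 := Hsum) (3 := Hsum).
  intros k; assert (Hk := pos_INR k).
  right; apply Rabs_pos_eq, Rlt_le, inv_pow_pos; lra.
Qed.

Lemma hurwitz_le (s : nat) (x y : R) :
  (2 <= s)%nat -> 0 < x <= y -> hurwitz s y <= hurwitz s x.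
Proof.
  intros Hs Hxy; apply Series_le; [|now apply ex_series_inv_pow_shift].
  intros k; assert (Hk := pos_INR k).
  split; [apply Rlt_le, inv_pow_pos|apply inv_pow_le]; lra.
Qed.

Lemma hurwitz_duplication (s : nat) (y : R) :
  (2 <= s)%nat -> 0 < y ->
  hurwitz s (y / 2) + hurwitz s ((y + 1) / 2) = 2 ^ s * hurwitz s y.
Proof.
  intros Hs Hy; unfold hurwitz at 3; rewrite <- Series_scal_l; symmetry.
  apply is_series_unique, is_series_even_odd.
  - apply is_series_ext with (2 := is_series_hurwitz s (y / 2) Hs ltac:(lra)).
    intros k; rewrite <- inv_pow_div, mult_INR; simpl (INR 2).
    do 2 f_equal; field.
  - apply is_series_ext with (2 := is_series_hurwitz s ((y + 1) / 2) Hs ltac:(lra)).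
    intros k; rewrite <- inv_pow_div, plus_INR, mult_INR; simpl (INR 2); simpl (INR 1).
    do 2 f_equal; field.
Qed.

(* The series of [(-1)^j / (2 j + 1)^s], split according to the parity of [j]. *)
Definition dirichlet_beta (s : nat) : R := (hurwitz s (1 / 4) - hurwitz s (3 / 4)) / 4 ^ s.

Lemma catalan_dirichlet_beta : catalan = dirichlet_beta 2.
Proof.
  replace (dirichlet_beta 2) with (/ 16 * hurwitz 2 (1 / 4) + - / 16 * hurwitz 2 (3 / 4))
    by (unfold dirichlet_beta; field).
  unfold catalan; apply is_series_unique, is_series_even_odd.
  - apply is_series_ext with (a := fun k => / 16 * / (1 / 4 + INR k) ^ 2).
    + intros k; assert (Hk := pos_INR k); rewrite pow_1_even, plus_INR, !mult_INR.
      simpl (INR _); equation_in_R; field; lra.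
    + apply (is_series_scal (V := R_NormedModule)), is_series_hurwitz; [lia|lra].
  - apply is_series_ext with (a := fun k => - / 16 * / (3 / 4 + INR k) ^ 2).
    + intros k; assert (Hk := pos_INR k).
      rewrite pow_add, pow_1_even, plus_INR, mult_INR, plus_INR, mult_INR.
      simpl (INR _); equation_in_R; field; lra.
    + apply (is_series_scal (V := R_NormedModule)), is_series_hurwitz; [lia|lra].
Qed.

(** * Termwise differentiation *)

Lemma is_derive_quadratic_remainder (f : R -> R) (x l C : R) :
  locally x (fun y => Rabs (f y - f x - l * (y - x)) <= C * (y - x) ^ 2) ->
  is_derive f x l.
Proof.
  intros Hf; split; [apply is_linear_scal_l|].
  intros z Hz eps.
  apply (@is_filter_lim_locally_unique R_AbsRing R_NormedModule) in Hz; subst z.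
  assert (He : 0 < eps / (Rabs C + 1)).
  { apply Rdiv_lt_0_compat; [apply cond_pos|assert (HC0 := Rabs_pos C); lra]. }
  generalize (filter_and _ _ Hf (locally_ball x (mkposreal _ He))).
  apply filter_imp; intros y [Hy Hd].
  change (Rabs (y - x) < eps / (Rabs C + 1)) in Hd.
  change (Rabs (f y - f x - (y - x) * l) <= eps * Rabs (y - x)).
  rewrite (Rmult_comm (y - x)).
  apply Rle_trans with (1 := Hy).
  rewrite <- pow2_abs.
  assert (HC0 := Rabs_pos C); assert (HC := Rle_abs C); assert (Hyx0 := Rabs_pos (y - x)).
  apply Rle_trans with ((Rabs C + 1) * Rabs (y - x) * Rabs (y - x)); [nra|].
  apply Rmult_le_compat_r; [assumption|].
  apply Rle_trans with ((Rabs C + 1) * (eps / (Rabs C + 1))); [nra|right; field; lra].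
Qed.

Lemma quadratic_remainder_le (f df ddf : R -> R) (x y c : R) :
  (forall t, Rabs (t - x) <= Rabs (y - x) ->
    is_derive f t (df t) /\ is_derive df t (ddf t) /\ Rabs (ddf t) <= c) ->
  Rabs (f y - f x - df x * (y - x)) <= c * (y - x) ^ 2.
Proof.
  intros Hder.
  assert (Hc : 0 <= c).
  { eapply Rle_trans; [apply Rabs_pos|apply (Hder x)].
    rewrite Rminus_diag, Rabs_R0; apply Rabs_pos. }
  assert (Hdf : forall t, Rabs (t - x) <= Rabs (y - x) ->
    Rabs (df t - df x) <= c * Rabs (y - x)).
  { intros t Ht; apply Rle_trans with (c * Rabs (t - x)); [|nra].
    apply bounded_variation with ddf; intros u Hu; apply Hder; lra. }
  replace (f y - f x - df x * (y - x)) with ((f y - df x * y) - (f x - df x * x)) by ring.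
  rewrite <- pow2_abs; replace (c * _) with (c * Rabs (y - x) * Rabs (y - x)) by ring.
  apply (bounded_variation (fun t => f t - df x * t) (fun t => df t - df x)).
  intros t Ht; split; [|now apply Hdf].
  destruct (Hder t Ht) as [Hf _].
  auto_derive; [now exists (df t)|].
  replace (Derive (fun u => f u) t) with (df t) by (symmetry; exact (is_derive_unique _ _ _ Hf)).
  ring.
Qed.

Lemma ex_series_approx (a b c : nat -> R) (h : R) :
  h <> 0 -> ex_series a -> (forall k, Rabs (a k - b k * h) <= c k) -> ex_series c ->
  ex_series b.
Proof.
  intros Hh Ha Hab Hc.
  apply ex_series_ext with (a := fun k => / h * (a k - (a k - b k * h))).
  { intros k; equation_in_R; field; assumption. }
  apply (ex_series_scal (/ h) (fun k => a k - (a k - b k * h))), (ex_series_minus a); auto.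
  now apply (ex_series_Rabs_le _ c).
Qed.

(* The domination of the second derivatives makes the series of derivatives converge: at any
   [y <> x] nearby its terms are the difference quotients up to an error of [c k * (y - x)]. *)
Lemma is_derive_series (phi dphi ddphi : nat -> R -> R) (c : nat -> R) (F : R -> R) (x : R) :
  ex_series c ->
  locally x (fun t => forall k,
    is_derive (phi k) t (dphi k t) /\ is_derive (dphi k) t (ddphi k t) /\
    Rabs (ddphi k t) <= c k) ->
  locally x (fun t => is_series (fun k => phi k t) (F t)) ->
  exists D, is_series (fun k => dphi k x) D /\ is_derive F x D.
Proof.
  intros [C HC] Hphi HF.
  destruct (filter_and _ _ Hphi HF) as [d Hd].
  assert (Hx : is_series (fun k => phi k x) (F x)) by apply Hd, ball_center.
  assert (Hrem : forall k y, ball x d y ->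
    Rabs (phi k y - phi k x - dphi k x * (y - x)) <= (y - x) ^ 2 * c k).
  { intros k y Hy; rewrite (Rmult_comm _ (c k)); apply quadratic_remainder_le with (ddphi k).
    intros t Ht; apply Hd; exact (Rle_lt_trans _ _ _ Ht Hy). }
  assert (Hdiff : forall y, ball x d y ->
    is_series (fun k => phi k y - phi k x) (F y - F x)).
  { intros y Hy; exact (is_series_minus _ _ _ _ (proj2 (Hd y Hy)) Hx). }
  assert (HD : ex_series (fun k => dphi k x)).
  { set (y := x + d / 2).
    assert (Hd0 := cond_pos d).
    assert (Hy : ball x d y) by (apply Rabs_lt_between'; unfold y; lra).
    apply ex_series_approx with (h := y - x) (3 := fun k => Hrem k y Hy).
    - unfold y; lra.
    - eexists; now apply Hdiff.
    - apply (ex_series_scal ((y - x) ^ 2) c); now exists C. }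
  destruct HD as [D HD]; exists D; split; [exact HD|].
  apply is_derive_quadratic_remainder with C; exists d; intros y Hy.
  rewrite (Rmult_comm C).
  apply Rabs_is_series_le with (1 := fun k => Hrem k y Hy).
  - apply (is_series_minus (fun k => phi k y - phi k x)); [now apply Hdiff|].
    apply (is_series_scal_r (y - x) (fun k => dphi k x)), HD.
  - apply (is_series_scal ((y - x) ^ 2) c), HC.
Qed.

Lemma is_derive_inv_pow_shift (a t : R) (s : nat) :
  0 < t + a -> is_derive (fun t => / (t + a) ^ s) t (- INR s * / (t + a) ^ S s).
Proof.
  intros Ht; assert (Hpow := pow_lt _ s Ht).
  auto_derive; [lra|].
  destruct s as [|s]; [simpl; field; lra|].
  assert (Hpow_pred := pow_lt _ s Ht).
  simpl Init.Nat.pred; change ((t + a) ^ S (S s)) with ((t + a) * ((t + a) * (t + a) ^ s)).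
  change ((t + a) ^ S s) with ((t + a) * (t + a) ^ s).
  field; lra.
Qed.

Lemma is_derive_series_inv_pow_shift (phi dphi : nat -> R -> R) (c : R) (s : nat)
    (F : R -> R) (y : R) :
  (2 <= s)%nat -> 0 < y ->
  (forall k t, 0 < t -> is_derive (phi k) t (dphi k t)) ->
  (forall k t, 0 < t -> is_derive (dphi k) t (c * / (t + INR k) ^ s)) ->
  (forall t, 0 < t -> is_series (fun k => phi k t) (F t)) ->
  exists D, is_series (fun k => dphi k y) D /\ is_derive F y D.
Proof.
  intros Hs Hy Hphi Hdphi HF.
  assert (Hloc : locally y (fun t => y / 2 < t)) by (apply open_gt; lra).
  apply is_derive_series with (phi := phi) (ddphi := fun k t => c * / (t + INR k) ^ s)
    (c := fun k => Rabs c * / (y / 2 + INR k) ^ s).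
  - apply (ex_series_scal (V := R_NormedModule) (Rabs c)).
    apply ex_series_inv_pow_shift; [assumption|lra].
  - revert Hloc; apply filter_imp; intros t Ht k.
    assert (Hk := pos_INR k).
    split; [|split]; [apply Hphi; lra|apply Hdphi; lra|].
    assert (Hterm0 : 0 < / (t + INR k) ^ s) by (apply inv_pow_pos; lra).
    rewrite Rabs_mult, (Rabs_pos_eq (/ _)) by lra.
    apply Rmult_le_compat_l; [apply Rabs_pos|apply inv_pow_le; lra].
  - revert Hloc; apply filter_imp; intros t Ht; apply HF; lra.
Qed.

Lemma is_derive_hurwitz (s : nat) (y : R) :
  (2 <= s)%nat -> 0 < y -> is_derive (hurwitz s) y (- INR s * hurwitz (S s) y).
Proof.
  intros Hs Hy.
  destruct (is_derive_series_inv_pow_shift (fun k t => / (t + INR k) ^ s)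
    (fun k t => - INR s * / (t + INR k) ^ S s) (- INR s * - INR (S s)) (S (S s))
    (hurwitz s) y) as [D [HD Hder]]; auto.
  - intros k t Ht; assert (Hk := pos_INR k); apply is_derive_inv_pow_shift; lra.
  - intros k t Ht; assert (Hk := pos_INR k); rewrite Rmult_assoc.
    apply (is_derive_scal (fun u => / (u + INR k) ^ S s)), is_derive_inv_pow_shift; lra.
  - intros t Ht; now apply is_series_hurwitz.
  - apply is_series_unique in HD; rewrite Series_scal_l in HD.
    now rewrite <- HD in Hder.
Qed.

(** * Euler's partial fraction expansion of the squared cosecant *)

Lemma bounded_duplication_eq_0 (g : R -> R) (M c : R) :
  2 < c ->
  (forall y, 0 < y < 1 -> Rabs (g y) <= M) ->
  (forall y, 0 < y < 1 -> g (y / 2) + g ((y + 1) / 2) = c * g y) ->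
  forall y, 0 < y < 1 -> g y = 0.
Proof.
  intros Hc HM Hg.
  assert (Hratio : 0 < 2 / c < 1).
  { split; [apply Rdiv_lt_0_compat; lra|apply Rlt_div_l; lra]. }
  assert (iterate : forall n y, 0 < y < 1 -> Rabs (g y) <= M * (2 / c) ^ n).
  { induction n as [|n IH]; intros y Hy; [rewrite Rmult_1_r; now apply HM|].
    replace (g y) with ((g (y / 2) + g ((y + 1) / 2)) / c)
      by (rewrite Hg by assumption; field; lra).
    unfold Rdiv at 1; rewrite Rabs_mult, Rabs_inv, (Rabs_pos_eq c) by lra.
    replace (M * (2 / c) ^ S n) with ((M * (2 / c) ^ n + M * (2 / c) ^ n) * / c)
      by (simpl; field; lra).
    apply Rmult_le_compat_r; [left; apply Rinv_0_lt_compat; lra|].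
    apply Rle_trans with (1 := Rabs_triang _ _), Rplus_le_compat; apply IH; lra. }
  intros y Hy.
  assert (Hlim : Rbar_le (Rabs (g y)) 0).
  { apply is_lim_seq_le with (1 := fun n => iterate n y Hy).
    - apply is_lim_seq_const.
    - rewrite <- (Rmult_0_r M).
      apply (is_lim_seq_scal_l _ M 0), is_lim_seq_geom; rewrite Rabs_pos_eq; lra. }
  apply Rabs_eq_0, Rle_antisym; [exact Hlim|apply Rabs_pos].
Qed.

Lemma inv_sqr_sin_bounded (u : R) : 0 < u <= PI / 2 -> 0 <= / sin u ^ 2 - / u ^ 2 <= 3.
Proof.
  intros Hu; assert (HPI := PI_4).
  assert (Hlt := sin_lt_x u (proj1 Hu)).
  assert (Hcubic : u - u ^ 3 / 6 <= sin u).
  { destruct (sin_bound u 0) as [Hsin _]; try lra.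
    apply Rle_trans with (2 := Hsin); right; unfold sin_approx, sin_term; simpl; field. }
  assert (Hthird : u / 3 <= sin u) by nra.
  set (v := sin u) in *.
  replace (/ v ^ 2 - / u ^ 2) with ((u - v) * (u + v) * / (u ^ 2 * v ^ 2)) by (field; lra).
  assert (Hpos : 0 < u ^ 2 * v ^ 2) by (apply Rmult_lt_0_compat; apply pow_lt; lra).
  split; [apply Rmult_le_pos; [nra|now apply Rlt_le, Rinv_0_lt_compat]|].
  apply Rmult_le_reg_r with (1 := Hpos); rewrite Rmult_assoc, Rinv_l, Rmult_1_r by lra.
  apply Rle_trans with (u ^ 3 / 6 * (2 * u)); [apply Rmult_le_compat; lra|].
  assert (Hsqr : (u / 3) ^ 2 <= v ^ 2) by (apply pow_incr; lra).
  assert (0 <= u ^ 2) by apply pow2_ge_0; nra.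
Qed.

Lemma csc_sqr_duplication (y : R) :
  0 < y < 1 ->
  (PI / sin (PI * (y / 2))) ^ 2 + (PI / sin (PI * ((y + 1) / 2))) ^ 2
  = 4 * (PI / sin (PI * y)) ^ 2.
Proof.
  intros Hy; assert (HPI := PI_RGT_0).
  assert (Hs : 0 < sin (PI * (y / 2))) by (apply sin_gt_0; nra).
  assert (Hc : 0 < cos (PI * (y / 2))) by (apply cos_gt_0; nra).
  replace (PI * ((y + 1) / 2)) with (PI / 2 + PI * (y / 2)) by field.
  replace (PI * y) with (2 * (PI * (y / 2))) by field.
  rewrite <- cos_sin, sin_2a.
  assert (Hsc := sin2_cos2 (PI * (y / 2))); unfold Rsqr in Hsc.
  set (s := sin (PI * (y / 2))) in *; set (c := cos (PI * (y / 2))) in *.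
  transitivity (PI ^ 2 * (s * s + c * c) / (s ^ 2 * c ^ 2)); [field; lra|].
  rewrite Hsc; field; lra.
Qed.

(* The sum of [1 / (y + k)^s] over all integers [k]. *)
Definition hurwitz_bilateral (s : nat) (y : R) : R :=
  hurwitz s y + (-1) ^ s * hurwitz s (1 - y).

Lemma hurwitz_bilateral_2 (y : R) : hurwitz_bilateral 2 y = hurwitz 2 y + hurwitz 2 (1 - y).
Proof. unfold hurwitz_bilateral; ring. Qed.

Lemma hurwitz_bilateral_2_duplication (y : R) :
  0 < y < 1 ->
  hurwitz_bilateral 2 (y / 2) + hurwitz_bilateral 2 ((y + 1) / 2) = 4 * hurwitz_bilateral 2 y.
Proof.
  intros Hy; rewrite !hurwitz_bilateral_2.
  assert (Hdup := hurwitz_duplication 2 y ltac:(lia) ltac:(lra)).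
  assert (Hdup' := hurwitz_duplication 2 (1 - y) ltac:(lia) ltac:(lra)).
  replace ((1 - y) / 2) with (1 - (y + 1) / 2) in Hdup' by field.
  replace ((1 - y + 1) / 2) with (1 - y / 2) in Hdup' by field.
  lra.
Qed.

Definition csc_defect (y : R) : R := hurwitz_bilateral 2 y - (PI / sin (PI * y)) ^ 2.

Lemma csc_defect_sym (y : R) : csc_defect (1 - y) = csc_defect y.
Proof.
  unfold csc_defect; rewrite !hurwitz_bilateral_2.
  replace (PI * (1 - y)) with (PI - PI * y) by ring; rewrite sin_PI_x.
  replace (1 - (1 - y)) with y by ring; ring.
Qed.

Lemma Rabs_csc_defect_le (y : R) :
  0 < y < 1 -> Rabs (csc_defect y) <= 2 * hurwitz 2 (1 / 2) + 3 * PI ^ 2.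
Proof.
  assert (HPI := PI_RGT_0); assert (HPI2 : 0 < PI ^ 2) by now apply pow_lt.
  assert (half : forall y, 0 < y <= 1 / 2 ->
    Rabs (csc_defect y) <= 2 * hurwitz 2 (1 / 2) + 3 * PI ^ 2).
  { clear y; intros y Hy.
    unfold csc_defect; rewrite hurwitz_bilateral_2, (hurwitz_succ 2 y) by (lia || lra).
    assert (Hsin : 0 < sin (PI * y)) by (apply sin_gt_0; nra).
    assert (Hleft := hurwitz_le 2 (1 / 2) (y + 1) ltac:(lia) ltac:(lra)).
    assert (Hright := hurwitz_le 2 (1 / 2) (1 - y) ltac:(lia) ltac:(lra)).
    assert (Hleft0 := hurwitz_nonneg 2 (y + 1) ltac:(lia) ltac:(lra)).
    assert (Hright0 := hurwitz_nonneg 2 (1 - y) ltac:(lia) ltac:(lra)).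
    assert (Hsing := inv_sqr_sin_bounded (PI * y) ltac:(nra)).
    assert (Epole : (PI / sin (PI * y)) ^ 2 - / y ^ 2
      = PI ^ 2 * (/ sin (PI * y) ^ 2 - / (PI * y) ^ 2)) by (field; lra).
    apply Rabs_le; nra. }
  intros Hy; destruct (Rle_lt_dec y (1 / 2)) as [Hle|Hlt]; [apply half; lra|].
  rewrite <- csc_defect_sym; apply half; lra.
Qed.

Lemma hurwitz_bilateral_2_csc (y : R) :
  0 < y < 1 -> hurwitz_bilateral 2 y = (PI / sin (PI * y)) ^ 2.
Proof.
  intros Hy; apply Rminus_diag_uniq; revert y Hy.
  apply (bounded_duplication_eq_0 csc_defect _ 4) with (2 := Rabs_csc_defect_le); [lra|].
  intros y Hy; unfold csc_defect.
  assert (Hcsc := csc_sqr_duplication y Hy).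
  assert (Hdup := hurwitz_bilateral_2_duplication y Hy); lra.
Qed.

(** * Rational polynomials in the cotangent *)

Definition rational (x : R) : Prop := exists a : Q, x = Q2R a.

Lemma rational_Z (z : Z) : rational (IZR z).
Proof. exists (inject_Z z); unfold Q2R; simpl; field. Qed.

Lemma rational_INR (n : nat) : rational (INR n).
Proof. rewrite INR_IZR_INZ; apply rational_Z. Qed.

Lemma rational_plus (x y : R) : rational x -> rational y -> rational (x + y).
Proof. intros [a ->] [b ->]; exists (a + b)%Q; now rewrite Q2R_plus. Qed.

Lemma rational_mult (x y : R) : rational x -> rational y -> rational (x * y).
Proof. intros [a ->] [b ->]; exists (a * b)%Q; now rewrite Q2R_mult. Qed.

Lemma rational_opp (x : R) : rational x -> rational (- x).
Proof. intros [a ->]; exists (- a)%Q; now rewrite Q2R_opp. Qed.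

Lemma rational_minus (x y : R) : rational x -> rational y -> rational (x - y).
Proof. intros; apply rational_plus; [|apply rational_opp]; assumption. Qed.

Lemma rational_inv (x : R) : rational x -> rational (/ x).
Proof.
  intros [a ->]; destruct (Qeq_dec a 0) as [Ha|Ha].
  - rewrite (Qeq_eqR _ _ Ha), RMicromega.Q2R_0, Rinv_0; apply (rational_Z 0).
  - exists (/ a)%Q; now rewrite Q2R_inv.
Qed.

Lemma rational_div (x y : R) : rational x -> rational y -> rational (x / y).
Proof. intros; apply rational_mult; [|apply rational_inv]; assumption. Qed.

Lemma rational_pow (x : R) (n : nat) : rational x -> rational (x ^ n).
Proof.
  intros Hx; induction n as [|n IH]; [apply (rational_Z 1)|now apply rational_mult].
Qed.

Create HintDb rational.
#[local] Hint Resolve rational_Z rational_INR rational_plus rational_mult rational_opp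
  rational_minus rational_inv rational_div rational_pow : rational.

Inductive rational_polynomial : (R -> R) -> Prop :=
| rational_polynomial_const (a : R) : rational a -> rational_polynomial (fun _ => a)
| rational_polynomial_id : rational_polynomial (fun x => x)
| rational_polynomial_plus (p q : R -> R) :
    rational_polynomial p -> rational_polynomial q ->
    rational_polynomial (fun x => p x + q x)
| rational_polynomial_mult (p q : R -> R) :
    rational_polynomial p -> rational_polynomial q ->
    rational_polynomial (fun x => p x * q x).

Lemma rational_polynomial_rational (p : R -> R) (a : R) :
  rational_polynomial p -> rational a -> rational (p a).
Proof. intros Hp Ha; induction Hp; auto with rational. Qed.

Lemma rational_polynomial_derive (p : R -> R) :
  rational_polynomial p ->
  exists dp, rational_polynomial dp /\ forall x, is_derive p x (dp x).
Proof.
  induction 1 as [a Ha| |p q Hp [dp [Hdp Ep]] Hq [dq [Hdq Eq]]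
                 |p q Hp [dp [Hdp Ep]] Hq [dq [Hdq Eq]]].
  - exists (fun _ => 0); split; [apply rational_polynomial_const, (rational_Z 0)|].
    intros x; apply (is_derive_const a).
  - exists (fun _ => 1); split; [apply rational_polynomial_const, (rational_Z 1)|].
    intros x; apply (is_derive_id (K := R_AbsRing)).
  - exists (fun x => dp x + dq x); split; [now apply rational_polynomial_plus|].
    intros x; apply (is_derive_plus p q); auto.
  - exists (fun x => dp x * q x + p x * dq x); split.
    + apply rational_polynomial_plus; now apply rational_polynomial_mult.
    + intros x; apply (is_derive_mult p q); auto; intros; apply Rmult_comm.
Qed.

Definition cot (x : R) : R := cos x / sin x.

Lemma csc_sqr_cot (x : R) : sin x <> 0 -> / sin x ^ 2 = 1 + cot x * cot x.
Proof.
  intros Hx; assert (Hpyth := sin2_cos2 x); unfold Rsqr in Hpyth; unfold cot.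
  replace (/ sin x ^ 2) with ((sin x * sin x + cos x * cos x) / sin x ^ 2)
    by (rewrite Hpyth; field; assumption).
  field; assumption.
Qed.

Lemma is_derive_cot_PI (y : R) :
  sin (PI * y) <> 0 ->
  is_derive (fun y => cot (PI * y)) y (- PI * (1 + cot (PI * y) * cot (PI * y))).
Proof.
  intros Hy; rewrite <- csc_sqr_cot by assumption.
  assert (Hpyth := sin2_cos2 (PI * y)); unfold Rsqr in Hpyth.
  unfold cot; auto_derive; [assumption|].
  transitivity (- PI * (sin (PI * y) * sin (PI * y) + cos (PI * y) * cos (PI * y))
    * / sin (PI * y) ^ 2); [field; assumption|].
  rewrite Hpyth; ring.
Qed.

Lemma is_derive_hurwitz_bilateral (s : nat) (y : R) :
  (2 <= s)%nat -> 0 < y < 1 ->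
  is_derive (hurwitz_bilateral s) y (- INR s * hurwitz_bilateral (S s) y).
Proof.
  intros Hs Hy; unfold hurwitz_bilateral.
  replace (- INR s * _) with (- INR s * hurwitz (S s) y
    + (-1) ^ s * (-1 * (- INR s * hurwitz (S s) (1 - y)))) by (simpl; ring).
  apply (is_derive_plus (hurwitz s)); [now apply is_derive_hurwitz|].
  apply is_derive_scal, (is_derive_comp (hurwitz s) (fun y => 1 - y)).
  - apply is_derive_hurwitz; [assumption|lra].
  - auto_derive; [exact I|ring].
Qed.

Lemma hurwitz_bilateral_cot (s : nat) :
  (2 <= s)%nat -> exists p, rational_polynomial p /\
    forall y, 0 < y < 1 -> hurwitz_bilateral s y = PI ^ s * p (cot (PI * y)).
Proof.
  assert (Hsin : forall y, 0 < y < 1 -> sin (PI * y) <> 0).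
  { intros y Hy; apply Rgt_not_eq, sin_gt_0; assert (HPI := PI_RGT_0); nra. }
  assert (Hsqr : rational_polynomial (fun x => 1 + x * x)).
  { apply rational_polynomial_plus.
    - apply rational_polynomial_const, (rational_Z 1).
    - apply rational_polynomial_mult; apply rational_polynomial_id. }
  induction 1 as [|s Hs [p [Hp Ep]]].
  - exists (fun x => 1 + x * x); split; [exact Hsqr|].
    intros y Hy; rewrite <- csc_sqr_cot, hurwitz_bilateral_2_csc by auto.
    field; auto.
  - destruct (rational_polynomial_derive p Hp) as [dp [Hdp Edp]].
    exists (fun x => / INR s * ((1 + x * x) * dp x)); split.
    { apply rational_polynomial_mult; [|now apply rational_polynomial_mult].
      apply rational_polynomial_const; auto with rational. }
    intros y Hy.
    assert (Hns : INR s <> 0) by (apply not_0_INR; lia).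
    apply Rmult_eq_reg_l with (- INR s); [|lra].
    rewrite <- (is_derive_unique _ _ _ (is_derive_hurwitz_bilateral s y Hs Hy)).
    apply is_derive_unique, (is_derive_ext_loc (fun t => PI ^ s * p (cot (PI * t)))).
    { apply (locally_interval _ y 0 1); try apply Hy.
      intros t Ht0 Ht1; symmetry; apply Ep; simpl in *; lra. }
    replace (- INR s * (PI ^ S s * (/ INR s * ((1 + cot (PI * y) * cot (PI * y))
      * dp (cot (PI * y)))))) with
      (PI ^ s * (- PI * (1 + cot (PI * y) * cot (PI * y)) * dp (cot (PI * y))))
      by (simpl; field; assumption).
    apply is_derive_scal, (is_derive_comp p); [apply Edp|now apply is_derive_cot_PI, Hsin].
Qed.

Lemma dirichlet_beta_odd (i : nat) :
  (1 <= i)%nat -> exists a, rational a /\ dirichlet_beta (2 * i + 1) = a * PI ^ (2 * i + 1).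
Proof.
  intros Hi; destruct (hurwitz_bilateral_cot (2 * i + 1) ltac:(lia)) as [p [Hp Ep]].
  exists (p 1 / 4 ^ (2 * i + 1)); split.
  { assert (Hp1 := rational_polynomial_rational p 1 Hp (rational_Z 1)); auto with rational. }
  assert (Hcot : cot (PI * (1 / 4)) = 1).
  { unfold cot; replace (PI * (1 / 4)) with (PI / 4) by field.
    rewrite cos_PI4, sin_PI4; field; apply Rgt_not_eq, sqrt_lt_R0; lra. }
  specialize (Ep (1 / 4) ltac:(lra)); unfold hurwitz_bilateral in Ep.
  rewrite Hcot, (pow_add (-1)), pow_1_even in Ep.
  replace (1 - 1 / 4) with (3 / 4) in Ep by field.
  unfold dirichlet_beta.
  replace (hurwitz (2 * i + 1) (1 / 4) - hurwitz (2 * i + 1) (3 / 4))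
    with (PI ^ (2 * i + 1) * p 1) by (rewrite <- Ep; ring).
  unfold Rdiv; ring.
Qed.

(** * Proper and improper integrals *)

Lemma is_RInt_eq (f : R -> R) (a b I J : R) : is_RInt f a b I -> is_RInt f a b J -> I = J.
Proof.
  intros HI HJ; apply (is_RInt_unique (V := R_CompleteNormedModule)) in HI, HJ; congruence.
Qed.

Lemma is_RInt_primitive (f df : R -> R) (a b : R) :
  a <= b ->
  (forall x, a <= x <= b -> is_derive f x (df x)) ->
  (forall x, a <= x <= b -> continuous df x) ->
  is_RInt df a b (f b - f a).
Proof.
  intros Hab Hf Hdf; apply (is_RInt_derive (V := R_CompleteNormedModule) f df);
    rewrite Rmin_left, Rmax_right by assumption; assumption.
Qed.

Local Notation is_RInt_half_line f l :=
  (is_RInt_gen f (at_right 0) (Rbar_locally p_infty) l).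

Lemma filter_prod_half_line (P : R * R -> Prop) (a0 b0 : R) :
  0 < a0 -> (forall a b, 0 < a < a0 -> b0 < b -> P (a, b)) ->
  filter_prod (at_right 0) (Rbar_locally p_infty) P.
Proof.
  intros Ha0 HP.
  apply Filter_prod with (Q := fun a => 0 < a < a0) (R := fun b => b0 < b).
  - exists (mkposreal a0 Ha0); intros a Ha Ha'.
    apply Rabs_lt_between' in Ha; simpl in Ha; lra.
  - now exists b0.
  - exact HP.
Qed.

Lemma RInt_subinterval_le (f : R -> R) (a a' b' b : R) :
  a <= a' -> a' <= b' -> b' <= b -> ex_RInt f a b -> (forall t, a < t < b -> 0 <= f t) ->
  RInt f a' b' <= RInt f a b.
Proof.
  intros Haa' Ha'b' Hb'b Hf Hpos.
  assert (Hab' := ex_RInt_Chasles_1 f a b' b ltac:(lra) Hf).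
  assert (Hb'b_int := ex_RInt_Chasles_2 f a b' b ltac:(lra) Hf).
  assert (Haa'_int := ex_RInt_Chasles_1 f a a' b' ltac:(lra) Hab').
  assert (Ha'b'_int := ex_RInt_Chasles_2 f a a' b' ltac:(lra) Hab').
  rewrite <- (RInt_Chasles f a b' b), <- (RInt_Chasles f a a' b') by assumption.
  assert (Hleft : 0 <= RInt f a a') by (apply RInt_ge_0; auto; intros t Ht; apply Hpos; lra).
  assert (Hright : 0 <= RInt f b' b) by (apply RInt_ge_0; auto; intros t Ht; apply Hpos; lra).
  unfold plus; simpl; lra.
Qed.

Lemma ex_RInt_continuous_pos (f : R -> R) (a b : R) :
  (forall t, 0 < t -> continuous f t) -> 0 < a -> a <= b -> ex_RInt f a b.
Proof.
  intros Hf Ha Hab.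
  apply (ex_RInt_continuous (V := R_CompleteNormedModule)); intros t Ht.
  rewrite Rmin_left in Ht by assumption; apply Hf; lra.
Qed.

Lemma is_RInt_half_line_sup (f : R -> R) (M : R) :
  (forall t, 0 < t -> continuous f t) -> (forall t, 0 < t -> 0 <= f t) ->
  (forall a b, 0 < a -> a <= b -> RInt f a b <= M) ->
  exists l, is_RInt_half_line f l /\ forall a b, 0 < a -> a <= b -> RInt f a b <= l.
Proof.
  intros Hf Hpos HM.
  destruct (completeness (fun I => exists a b, 0 < a /\ a <= b /\ I = RInt f a b))
    as [l [Hub Hlub]].
  { exists M; intros I [a [b [Ha [Hab ->]]]]; now apply HM. }
  { exists (RInt f 1 1), 1, 1; repeat split; lra. }
  assert (Hle : forall a b, 0 < a -> a <= b -> RInt f a b <= l).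
  { intros a b Ha Hab; apply Hub; now exists a, b. }
  exists l; split; [|exact Hle].
  intros P [d HP].
  assert (Hclose : exists a0 b0, 0 < a0 /\ a0 <= b0 /\ l - d < RInt f a0 b0).
  { apply Classical_Prop.NNPP; intros Hfar.
    assert (Hd := cond_pos d).
    assert (l <= l - d); [|lra].
    apply Hlub; intros I [a [b [Ha [Hab ->]]]].
    apply Rnot_lt_le; intros Hlt; apply Hfar; now exists a, b. }
  destruct Hclose as [a0 [b0 [Ha0 [Hab0 Hclose]]]].
  apply filter_prod_half_line with a0 b0; [assumption|]; intros a b Ha Hb.
  assert (Hint := ex_RInt_continuous_pos f a b Hf ltac:(lra) ltac:(lra)).
  exists (RInt f a b); split; [exact (RInt_correct f a b Hint)|].
  apply HP, Rabs_lt_between'.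
  assert (Hle_ab := Hle a b ltac:(lra) ltac:(lra)).
  assert (Hsub : RInt f a0 b0 <= RInt f a b).
  { apply RInt_subinterval_le; auto; try lra; intros t Ht; apply Hpos; lra. }
  assert (Hd := cond_pos d); lra.
Qed.

Lemma is_RInt_half_line_derive (f df : R -> R) (la lb : R) :
  (forall t, 0 < t -> is_derive f t (df t)) -> (forall t, 0 < t -> continuous df t) ->
  filterlim f (at_right 0) (locally la) ->
  filterlim f (Rbar_locally p_infty) (locally lb) ->
  is_RInt_half_line df (lb - la).
Proof.
  intros Hf Hdf Hla Hlb.
  assert (Hpos : forall P : R -> Prop, (forall t, 0 < t -> P t) ->
    filter_prod (at_right 0) (Rbar_locally p_infty)
      (fun ab => forall t, Rmin (fst ab) (snd ab) <= t <= Rmax (fst ab) (snd ab) -> P t)).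
  { intros P HP; apply filter_prod_half_line with 1 1; [lra|].
    intros a b Ha Hb t; simpl; rewrite Rmin_left by lra; intros Ht; apply HP; lra. }
  apply is_RInt_gen_ext with (f := Derive f).
  - generalize (Hpos _ (fun t Ht => is_derive_unique _ _ _ (Hf t Ht))).
    apply filter_imp; intros ab Heq t Ht; apply Heq; lra.
  - apply is_RInt_gen_Derive; try assumption; apply Hpos; intros t Ht.
    + eexists; now apply Hf.
    + apply continuous_ext_loc with (g := df); [|now apply Hdf].
      apply (locally_interval _ t 0 p_infty); simpl; auto.
      intros u Hu _; symmetry; now apply is_derive_unique, Hf.
Qed.

(** * The Gamma function *)

Definition gamma_integrand (x t : R) : R := Rpower t (x - 1) * exp (- t).

Lemma Rpower_pos (t x : R) : 0 < Rpower t x.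
Proof. apply exp_pos. Qed.

Lemma gamma_integrand_pos (x t : R) : 0 < gamma_integrand x t.
Proof. apply Rmult_lt_0_compat; apply exp_pos. Qed.

Lemma continuous_gamma_integrand (x t : R) : 0 < t -> continuous (gamma_integrand x) t.
Proof.
  intros Ht; apply (ex_derive_continuous (gamma_integrand x)).
  unfold gamma_integrand, Rpower; auto_derive; assumption.
Qed.

Lemma pow_div_fact_le_exp (x : R) (n : nat) : 0 <= x -> x ^ n / INR (fact n) <= exp x.
Proof.
  intros Hx; apply Rle_trans with (2 := exp_ge_taylor x n Hx).
  destruct n as [|n]; [simpl; lra|rewrite tech5].
  assert (0 <= sum_f_R0 (fun k => x ^ k / INR (fact k)) n); [|lra].
  apply cond_pos_sum; intros k.
  apply Rmult_le_pos; [now apply pow_le|left; apply Rinv_0_lt_compat, INR_fact_lt_0].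
Qed.

Lemma one_plus_Rpower_sqr_le_exp (x : R) :
  0 < x -> exists c, forall t, 0 < t -> 1 + Rpower t x ^ 2 <= c * exp t.
Proof.
  intros Hx; destruct (INR_unbounded x) as [N HN].
  exists (2 * INR (fact (N * 2)) * exp 1); intros t Ht.
  assert (Hpow : Rpower t x <= (1 + t) ^ N).
  { rewrite <- Rpower_pow by lra.
    apply Rle_trans with (Rpower (1 + t) x); [apply Rle_Rpower_l|apply Rle_Rpower]; lra. }
  assert (Hsqr : Rpower t x ^ 2 <= (1 + t) ^ (N * 2)).
  { rewrite pow_mult; apply pow_incr; split; [apply Rlt_le, Rpower_pos|exact Hpow]. }
  assert (Hone : 1 <= (1 + t) ^ (N * 2)) by (apply pow_R1_Rle; lra).
  assert (Hexp := pow_div_fact_le_exp (1 + t) (N * 2) ltac:(lra)).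
  assert (Hfact := INR_fact_lt_0 (N * 2)).
  apply Rle_div_l in Hexp; [|exact Hfact].
  rewrite exp_plus in Hexp; lra.
Qed.

Lemma is_derive_Rpower (x t : R) :
  0 < t -> is_derive (fun t => Rpower t x) t (x * Rpower t (x - 1)).
Proof. intros Ht; now apply is_derive_Reals, derivable_pt_lim_power. Qed.

(* The integrand is dominated by [c * t^(x-1) / (1 + t^(2x))], which has the bounded primitive
   [c / x * atan (t^x)]. *)
Lemma RInt_gamma_integrand_bounded (x : R) :
  0 < x -> exists M, forall a b, 0 < a -> a <= b -> RInt (gamma_integrand x) a b <= M.
Proof.
  intros Hx; destruct (one_plus_Rpower_sqr_le_exp x Hx) as [c Hc].
  exists (Rabs (c / x) * PI); intros a b Ha Hab.
  set (B := fun t => c / x * atan (Rpower t x)).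
  set (dB := fun t => c * Rpower t (x - 1) / (1 + Rpower t x ^ 2)).
  assert (HdB : is_RInt dB a b (B b - B a)).
  { apply is_RInt_primitive; [exact Hab| |]; intros t Ht; assert (HR := Rpower_pos t x).
    - unfold B, dB; replace (c * Rpower t (x - 1) / (1 + Rpower t x ^ 2))
        with (c / x * ((x * Rpower t (x - 1)) * / (1 + Rsqr (Rpower t x))))
        by (unfold Rsqr; field; nra).
      apply is_derive_scal, (is_derive_comp atan (fun t => Rpower t x)).
      + apply is_derive_atan.
      + apply is_derive_Rpower; lra.
    - apply (ex_derive_continuous dB); unfold dB, Rpower in *; auto_derive.
      repeat split; try lra; nra. }
  apply Rle_trans with (B b - B a).
  - apply is_RInt_le with (f := gamma_integrand x) (3 := HdB) (1 := Hab).
    { apply (RInt_correct (V := R_CompleteNormedModule)), ex_RInt_continuous_pos; auto.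
      apply continuous_gamma_integrand. }
    intros t Ht; specialize (Hc t ltac:(lra)).
    unfold gamma_integrand, dB.
    assert (HR := Rpower_pos t x); assert (Hexp := exp_pos t).
    replace (c * Rpower t (x - 1) / (1 + Rpower t x ^ 2))
      with (Rpower t (x - 1) * (c / (1 + Rpower t x ^ 2))) by (field; nra).
    apply Rmult_le_compat_l; [apply Rlt_le, Rpower_pos|].
    rewrite exp_Ropp; apply Rle_div_r; [nra|].
    rewrite Rmult_comm; apply Rle_div_l; [exact Hexp|exact Hc].
  - unfold B; rewrite <- Rmult_minus_distr_l.
    assert (Hb := atan_bound (Rpower b x)); assert (Ha' := atan_bound (Rpower a x)).
    apply Rle_trans with (1 := Rle_abs _); rewrite Rabs_mult.
    apply Rmult_le_compat_l; [apply Rabs_pos|apply Rabs_le; lra].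
Qed.

Lemma Gamma_sup (x : R) :
  0 < x -> is_RInt_half_line (gamma_integrand x) (Gamma x) /\
    forall a b, 0 < a -> a <= b -> RInt (gamma_integrand x) a b <= Gamma x.
Proof.
  intros Hx; destruct (RInt_gamma_integrand_bounded x Hx) as [M HM].
  destruct (is_RInt_half_line_sup (gamma_integrand x) M) as [l [Hl Hle]]; auto.
  - intros t; apply continuous_gamma_integrand.
  - intros t _; apply Rlt_le, gamma_integrand_pos.
  - replace (Gamma x) with l; [now split|].
    symmetry; exact (is_RInt_gen_unique (V := R_CompleteNormedModule) _ _ Hl).
Qed.

Lemma is_RInt_half_line_Gamma (x : R) :
  0 < x -> is_RInt_half_line (gamma_integrand x) (Gamma x).
Proof. intros Hx; now apply Gamma_sup. Qed.

Lemma Gamma_pos (x : R) : 0 < x -> 0 < Gamma x.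
Proof.
  intros Hx; apply Rlt_le_trans with (RInt (gamma_integrand x) 1 2).
  - apply RInt_gt_0; [lra| |].
    + intros t _; apply gamma_integrand_pos.
    + intros t Ht; apply continuous_gamma_integrand; lra.
  - apply Gamma_sup; lra.
Qed.

Lemma filterlim_Rpower_0 (x : R) :
  0 < x -> filterlim (fun t => Rpower t x) (at_right 0) (locally 0).
Proof.
  intros Hx; apply (filterlim_comp _ _ _ (fun t => x * ln t) exp _ (Rbar_locally m_infty)).
  - apply filterlim_comp with (1 := is_lim_ln_0).
    intros P [M HM]; exists (M / x); intros u Hu; apply HM.
    rewrite Rmult_comm; now apply Rlt_div_r.
  - exact is_lim_exp_m.
Qed.

Lemma filterlim_Rpower_mul_exp_0 (x : R) :
  0 < x -> filterlim (fun t => Rpower t x * exp (- t)) (at_right 0) (locally 0).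
Proof.
  intros Hx.
  assert (Hexp : filterlim (fun t => exp (- t)) (at_right 0) (locally (exp (- 0)))).
  { apply filterlim_filter_le_1 with (1 := filter_le_within (F := locally 0) _).
    apply (ex_derive_continuous (fun t => exp (- t))); auto_derive; exact I. }
  assert (Hprod : filterlim (fun t => Rpower t x * exp (- t)) (at_right 0)
    (locally (0 * exp (- 0)))).
  { exact (filterlim_comp_2 _ _ Rmult (filterlim_Rpower_0 x Hx) Hexp
      (filterlim_mult (K := R_AbsRing) 0 (exp (- 0)))). }
  now rewrite Rmult_0_l in Hprod.
Qed.

Lemma filterlim_Rpower_mul_exp_p_infty (x : R) :
  0 < x -> filterlim (fun t => Rpower t x * exp (- t)) (Rbar_locally p_infty) (locally 0).
Proof.
  intros Hx; destruct (one_plus_Rpower_sqr_le_exp (x + 1) ltac:(lra)) as [c Hc].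
  assert (Hbound : forall t, 0 < t -> 0 <= Rpower t x * exp (- t) <= c / t).
  { intros t Ht; specialize (Hc t Ht).
    rewrite Rpower_plus, Rpower_1 in Hc by assumption.
    assert (HR := Rpower_pos t x); assert (Hexp := exp_pos t); rewrite exp_Ropp.
    split; [apply Rlt_le, Rmult_lt_0_compat; [|apply Rinv_0_lt_compat]; assumption|].
    apply (Rle_div_r _ _ t Ht).
    replace (Rpower t x * / exp t * t) with (Rpower t x * t / exp t) by (field; lra).
    apply (Rle_div_l _ _ _ Hexp).
    assert (0 <= (Rpower t x * t - 1) ^ 2) by apply pow2_ge_0; nra. }
  apply (is_lim_le_le_loc (fun _ => 0) (fun t => c / t) _ p_infty 0).
  - exists 0; apply Hbound.
  - apply is_lim_const.
  - rewrite <- (Rmult_0_r c); apply (is_lim_scal_l Rinv c p_infty 0).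
    apply (is_lim_inv (fun t => t) p_infty p_infty); [apply is_lim_id|discriminate].
Qed.

Lemma Gamma_succ (x : R) : 0 < x -> Gamma (x + 1) = x * Gamma x.
Proof.
  intros Hx; set (df := fun t => gamma_integrand (x + 1) t - x * gamma_integrand x t).
  assert (Hint : is_RInt_half_line df (Gamma (x + 1) - x * Gamma x)).
  { apply (is_RInt_gen_minus (V := R_NormedModule));
      [|apply (is_RInt_gen_scal (V := R_NormedModule))]; apply is_RInt_half_line_Gamma; lra. }
  assert (Hprim : is_RInt_half_line df (- 0 - - 0)).
  { apply is_RInt_half_line_derive with (f := fun t => - (Rpower t x * exp (- t))).
    - intros t Ht; unfold df, gamma_integrand, Rpower; auto_derive; [assumption|].
      replace ((x + 1 - 1) * ln t) with (x * ln t) by ring.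
      replace ((x - 1) * ln t) with (x * ln t + - ln t) by ring.
      rewrite exp_plus, (exp_Ropp (ln t)), exp_ln by assumption.
      field; lra.
    - intros t Ht; apply (continuous_minus (gamma_integrand (x + 1))).
      + now apply continuous_gamma_integrand.
      + now apply (continuous_scal_r x (gamma_integrand x)), continuous_gamma_integrand.
    - exact (filterlim_comp _ _ _ _ _ _ _ _
        (filterlim_Rpower_mul_exp_0 x Hx) (filterlim_opp (V := R_NormedModule) 0)).
    - exact (filterlim_comp _ _ _ _ _ _ _ _
        (filterlim_Rpower_mul_exp_p_infty x Hx) (filterlim_opp (V := R_NormedModule) 0)). }
  apply (is_RInt_gen_unique (V := R_CompleteNormedModule)) in Hint, Hprim.
  rewrite Hint in Hprim; lra.
Qed.

(* Weighted AM-GM for [s] and [t], from [exp u >= 1 + u] at [- l (ln t - ln s)] and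
   [(1 - l) (ln t - ln s)]. *)
Lemma Rpower_le_affine (s t l : R) :
  0 < s -> 0 < t -> 0 <= l <= 1 ->
  Rpower t l <= Rpower s l * ((1 - l) + l / s * t).
Proof.
  intros Hs Ht Hl; set (y := ln t - ln s).
  assert (Ets : t / s = exp y).
  { unfold y, Rminus; now rewrite exp_plus, exp_Ropp, !exp_ln. }
  assert (Etl : Rpower t l = Rpower s l * exp (l * y)).
  { unfold Rpower; rewrite <- exp_plus; f_equal; unfold y; ring. }
  rewrite Etl; apply Rmult_le_compat_l; [apply Rlt_le, Rpower_pos|].
  replace (l / s * t) with (l * (t / s)) by (field; lra); rewrite Ets.
  assert (Hexp_s := exp_ineq1_le (- (l * y))); assert (Hexp_t := exp_ineq1_le (y + - (l * y))).
  assert (Hexp_pos := exp_pos (l * y)).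
  replace ((1 - l) + l * exp y) with
    (((1 - l) * exp (- (l * y)) + l * exp (y + - (l * y))) * exp (l * y)).
  - rewrite <- (Rmult_1_l (exp (l * y))) at 1.
    apply Rmult_le_compat_r; [lra|].
    apply Rle_trans with ((1 - l) * (1 + - (l * y)) + l * (1 + (y + - (l * y)))).
    + right; ring.
    + apply Rplus_le_compat; apply Rmult_le_compat_l; lra.
  - rewrite exp_plus, exp_Ropp; field; lra.
Qed.

Lemma gamma_integrand_add_le (s l t : R) :
  0 < s -> 0 <= l <= 1 -> 0 < t ->
  gamma_integrand (s + l) t
  <= Rpower s l * ((1 - l) * gamma_integrand s t + l / s * gamma_integrand (s + 1) t).
Proof.
  intros Hs Hl Ht; unfold gamma_integrand.
  replace (s + l - 1) with (s - 1 + l) by ring.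
  replace (s + 1 - 1) with (s - 1 + 1) by ring.
  rewrite !Rpower_plus, Rpower_1 by assumption.
  assert (Hpos : 0 < Rpower t (s - 1) * exp (- t)) by (apply Rmult_lt_0_compat; apply exp_pos).
  assert (Hamgm := Rpower_le_affine s t l Hs Ht Hl).
  apply Rmult_le_compat_l with (r := Rpower t (s - 1) * exp (- t)) in Hamgm; lra.
Qed.

Lemma Gamma_add_le (s l : R) :
  0 < s -> 0 <= l <= 1 -> Gamma (s + l) <= Rpower s l * Gamma s.
Proof.
  intros Hs Hl.
  replace (Rpower s l * Gamma s)
    with (Rpower s l * ((1 - l) * Gamma s + l / s * Gamma (s + 1)))
    by (rewrite Gamma_succ by assumption; field; lra).
  apply Rle_trans with (1 := Rle_abs _).
  apply (RInt_gen_norm (V := R_CompleteNormedModule)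
    (Fa := at_right 0) (Fb := Rbar_locally p_infty) (gamma_integrand (s + l))
    (fun t => Rpower s l * ((1 - l) * gamma_integrand s t + l / s * gamma_integrand (s + 1) t))).
  - apply filter_prod_half_line with 1 1; [lra|]; intros a b Ha Hb; simpl; lra.
  - apply filter_prod_half_line with 1 1; [lra|]; intros a b Ha Hb t Ht; simpl in Ht.
    apply Rle_trans with (gamma_integrand (s + l) t).
    + right; apply Rabs_pos_eq, Rlt_le, gamma_integrand_pos.
    + apply gamma_integrand_add_le; lra.
  - apply is_RInt_half_line_Gamma; lra.
  - apply (is_RInt_gen_scal (V := R_NormedModule)), (is_RInt_gen_plus (V := R_NormedModule));
      apply (is_RInt_gen_scal (V := R_NormedModule)), is_RInt_half_line_Gamma; lra.
Qed.

Lemma ln_Gamma_succ (x : R) : 0 < x -> ln (Gamma (x + 1)) = ln x + ln (Gamma x).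
Proof. intros Hx; rewrite Gamma_succ, ln_mult by auto using Gamma_pos; reflexivity. Qed.

Lemma ln_Gamma_add_le (s l : R) :
  0 < s -> 0 <= l <= 1 -> ln (Gamma (s + l)) <= l * ln s + ln (Gamma s).
Proof.
  intros Hs Hl; rewrite <- (ln_Rpower s l), <- ln_mult by auto using Gamma_pos, Rpower_pos.
  apply ln_le; [apply Gamma_pos; lra|now apply Gamma_add_le].
Qed.

(** * Euler's series for [ln Gamma] and the polygamma functions *)

Lemma ln_add_sub_ln_bounds (x y : R) : 0 < x -> 0 <= y -> 0 <= ln (x + y) - ln x <= y / x.
Proof.
  intros Hx Hy; split.
  { assert (ln x <= ln (x + y)) by (apply ln_le; lra); lra. }
  assert (Hexp := exp_ineq1_le (ln (x + y) - ln x)).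
  unfold Rminus in Hexp; rewrite exp_plus, exp_Ropp, !exp_ln in Hexp by lra.
  replace ((x + y) * / x) with (1 + y / x) in Hexp by (field; lra); lra.
Qed.

Lemma is_lim_seq_div_S (y : R) : is_lim_seq (fun n => y / INR (S n)) 0.
Proof.
  apply is_lim_seq_ext with (u := fun n => y * / (1 + INR n)).
  { intros n; now rewrite S_INR, Rplus_comm. }
  rewrite <- (Rmult_0_r y); apply (is_lim_seq_scal_l _ y 0), is_lim_seq_inv_shift.
Qed.

Lemma is_lim_seq_ln_add_sub_ln (y : R) :
  0 <= y -> is_lim_seq (fun n => ln (INR (S n) + y) - ln (INR (S n))) 0.
Proof.
  intros Hy; apply is_lim_seq_le_le with (u := fun _ => 0) (w := fun n => y / INR (S n)).
  - intros n; apply ln_add_sub_ln_bounds; [apply lt_0_INR; lia|assumption].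
  - apply is_lim_seq_const.
  - apply is_lim_seq_div_S.
Qed.

Definition ln_Gamma_add_error (y : R) (n : nat) : R :=
  ln (Gamma (INR (S n) + y)) - ln (Gamma (INR (S n))) - y * ln (INR (S n)).

Lemma is_lim_seq_ln_Gamma_add_error_unit (y : R) :
  0 <= y <= 1 -> is_lim_seq (ln_Gamma_add_error y) 0.
Proof.
  intros Hy.
  apply is_lim_seq_le_le with (u := fun n => (- y) / INR (S n)) (w := fun _ => 0);
    [|apply is_lim_seq_div_S|apply is_lim_seq_const].
  intros n; assert (Hn : 0 < INR (S n)) by (apply lt_0_INR; lia).
  unfold ln_Gamma_add_error; set (N := INR (S n)) in *.
  assert (Hup := ln_Gamma_add_le N y Hn Hy).
  assert (Hlow := ln_Gamma_add_le (N + y) (1 - y) ltac:(lra) ltac:(lra)).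
  replace (N + y + (1 - y)) with (N + 1) in Hlow by ring.
  rewrite ln_Gamma_succ in Hlow by assumption.
  assert (Hln := ln_add_sub_ln_bounds N y Hn (proj1 Hy)).
  replace (- y / N) with (- (y / N)) by (field; lra).
  split; nra.
Qed.

Lemma is_lim_seq_ln_Gamma_add_error (y : R) :
  0 <= y -> is_lim_seq (ln_Gamma_add_error y) 0.
Proof.
  intros Hy; destruct (INR_unbounded y) as [m Hm]; apply Rlt_le in Hm.
  revert y Hy Hm; induction m as [|m IH]; intros y Hy Hm;
    [simpl in Hm; apply is_lim_seq_ln_Gamma_add_error_unit; lra|].
  destruct (Rle_lt_dec y 1) as [Hy1|Hy1];
    [now apply is_lim_seq_ln_Gamma_add_error_unit|].
  rewrite S_INR in Hm.
  assert (Hlim := is_lim_seq_plus' _ _ _ _ (is_lim_seq_ln_add_sub_ln (y - 1) ltac:(lra))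
    (IH (y - 1) ltac:(lra) ltac:(lra))).
  rewrite Rplus_0_r in Hlim; revert Hlim; apply is_lim_seq_ext; intros n.
  assert (Hn : 0 < INR (S n)) by (apply lt_0_INR; lia).
  unfold ln_Gamma_add_error.
  replace (INR (S n) + y) with (INR (S n) + (y - 1) + 1) by ring.
  rewrite ln_Gamma_succ by lra; ring.
Qed.

(* The logarithm of the [k]-th factor [((k+2)/(k+1))^(y-1) * (k+1)/(y+k)] of Euler's product for
   [Gamma y]. *)
Definition ln_Gamma_term (k : nat) (y : R) : R :=
  (y - 1) * (ln (INR k + 2) - ln (INR k + 1)) - ln (y + INR k) + ln (INR k + 1).

Lemma sum_ln_Gamma_term (y : R) (n : nat) :
  0 < y ->
  sum_n (fun k => ln_Gamma_term k y) n =
  (y - 1) * ln (INR (S n) + 1) - (ln (Gamma (INR (S n) + y)) - ln (Gamma y))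
  + (ln (Gamma (INR (S n) + 1)) - ln (Gamma 1)).
Proof.
  intros Hy; induction n as [|n IH].
  - rewrite sum_O; unfold ln_Gamma_term; simpl (INR _).
    rewrite (Rplus_comm 1 y), !ln_Gamma_succ by lra.
    rewrite Rplus_0_l, Rplus_0_r, Rplus_0_l, ln_1.
    replace (1 + 1) with 2 by ring; equation_in_R; ring.
  - rewrite sum_Sn, IH; unfold ln_Gamma_term, plus; simpl plus.
    assert (Hn : 0 < INR (S n)) by (apply lt_0_INR; lia).
    rewrite (S_INR (S n)); set (N := INR (S n)) in *.
    replace (N + 1 + y) with (N + y + 1) by ring.
    replace (N + 2) with (N + 1 + 1) by ring.
    rewrite (ln_Gamma_succ (N + y)), (ln_Gamma_succ (N + 1)), (Rplus_comm y) by lra.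
    equation_in_R; simpl; ring.
Qed.

Lemma is_series_ln_Gamma (y : R) :
  0 < y -> is_series (fun k => ln_Gamma_term k y) (ln (Gamma y) - ln (Gamma 1)).
Proof.
  intros Hy.
  change (is_lim_seq (sum_n (fun k => ln_Gamma_term k y)) (ln (Gamma y) - ln (Gamma 1))).
  assert (Hlim := is_lim_seq_minus' _ _ _ _
    (is_lim_seq_scal_l _ (y - 1) 0 (is_lim_seq_ln_add_sub_ln 1 ltac:(lra)))
    (is_lim_seq_ln_Gamma_add_error y ltac:(lra))).
  assert (Hsum := is_lim_seq_plus' _ _ _ _
    (is_lim_seq_const (ln (Gamma y) - ln (Gamma 1))) Hlim).
  rewrite Rmult_0_r, Rminus_0_r, Rplus_0_r in Hsum.
  revert Hsum; apply is_lim_seq_ext; intros n.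
  assert (Hn : 0 < INR (S n)) by (apply lt_0_INR; lia).
  unfold ln_Gamma_add_error.
  rewrite sum_ln_Gamma_term, (ln_Gamma_succ (INR (S n))) by assumption; ring.
Qed.

Definition digamma_term (k : nat) (y : R) : R :=
  ln (INR k + 2) - ln (INR k + 1) - / (y + INR k).

Lemma is_derive_ln_Gamma_term (k : nat) (y : R) :
  0 < y -> is_derive (ln_Gamma_term k) y (digamma_term k y).
Proof.
  intros Hy; assert (Hk := pos_INR k).
  unfold ln_Gamma_term, digamma_term; auto_derive; [lra|field; lra].
Qed.

Lemma is_derive_digamma_term (k : nat) (y : R) :
  0 < y -> is_derive (digamma_term k) y (/ (y + INR k) ^ 2).
Proof.
  intros Hy; assert (Hk := pos_INR k).
  unfold digamma_term; auto_derive; [lra|field; lra].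
Qed.

Lemma digamma_ln_Gamma (c y D : R) :
  0 < y -> is_derive (fun t => ln (Gamma t) - c) y D -> digamma y = D.
Proof.
  intros Hy HD; assert (HG := Gamma_pos y Hy).
  assert (Hder : is_derive Gamma y (D * Gamma y)).
  { apply is_derive_ext_loc with (f := fun t => exp (ln (Gamma t) - c + c)).
    - apply (locally_interval _ y 0 p_infty); simpl; auto.
      intros t Ht _; replace (_ + c) with (ln (Gamma t)) by ring.
      now apply exp_ln, Gamma_pos.
    - replace (Gamma y) with (exp (ln (Gamma y) - c + c))
        by (replace (_ + c) with (ln (Gamma y)) by ring; now apply exp_ln).
      apply (is_derive_comp exp (fun t => ln (Gamma t) - c + c)); [apply is_derive_exp|].
      rewrite <- (Rplus_0_r D).
      apply (is_derive_plus (fun t => ln (Gamma t) - c)); [exact HD|].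
      apply (is_derive_const (V := R_NormedModule)). }
  unfold digamma; rewrite (is_derive_unique _ _ _ Hder); field; lra.
Qed.

Lemma is_series_digamma (y : R) :
  0 < y -> is_series (fun k => digamma_term k y) (digamma y).
Proof.
  intros Hy.
  destruct (is_derive_series_inv_pow_shift ln_Gamma_term digamma_term 1 2
    (fun y => ln (Gamma y) - ln (Gamma 1)) y) as [D [HD Hder]]; auto.
  - apply is_derive_ln_Gamma_term.
  - intros k t Ht; rewrite Rmult_1_l; now apply is_derive_digamma_term.
  - apply is_series_ln_Gamma.
  - now rewrite (digamma_ln_Gamma _ y D Hy Hder).
Qed.

Lemma is_derive_digamma (y : R) : 0 < y -> is_derive digamma y (hurwitz 2 y).
Proof.
  intros Hy.
  destruct (is_derive_series_inv_pow_shift digamma_term (fun k t => / (t + INR k) ^ 2)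
    (- INR 2) 3 digamma y) as [D [HD Hder]]; auto.
  - apply is_derive_digamma_term.
  - intros k t Ht; assert (Hk := pos_INR k); apply is_derive_inv_pow_shift; lra.
  - apply is_series_digamma.
  - unfold hurwitz; now rewrite (is_series_unique _ _ HD).
Qed.

Lemma polygamma_hurwitz (m : nat) (y : R) :
  0 < y -> polygamma (S m) y = (-1) ^ m * INR (fact (S m)) * hurwitz (S (S m)) y.
Proof.
  revert y; induction m as [|m IH]; intros y Hy; unfold polygamma in *.
  - rewrite pow_O, !Rmult_1_l; now apply is_derive_unique, is_derive_digamma.
  - apply is_derive_unique, (is_derive_ext_loc
      (fun t => (-1) ^ m * INR (fact (S m)) * hurwitz (S (S m)) t)).
    { apply (locally_interval _ y 0 p_infty); simpl; auto.
      intros t Ht _; symmetry; now apply IH. }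
    replace (_ * hurwitz (S (S (S m))) y) with
      ((-1) ^ m * INR (fact (S m)) * (- INR (S (S m)) * hurwitz (S (S (S m))) y))
      by (rewrite (fact_simpl (S m)), mult_INR, <- tech_pow_Rmult; ring).
    apply (is_derive_scal (hurwitz (S (S m)))), is_derive_hurwitz; [lia|exact Hy].
Qed.

Definition polygamma_quarters (j : nat) : R :=
  polygamma (2 * j - 1) (1 / 4) - polygamma (2 * j - 1) (3 / 4).

Lemma dirichlet_beta_even (j : nat) :
  (1 <= j)%nat ->
  dirichlet_beta (2 * j) = / (4 ^ (2 * j) * INR (fact (2 * j - 1))) * polygamma_quarters j.
Proof.
  intros Hj; destruct j as [|j]; [lia|]; unfold dirichlet_beta, polygamma_quarters.
  replace (2 * S j - 1)%nat with (S (2 * j)) by lia.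
  replace (2 * S j)%nat with (S (S (2 * j))) by lia.
  rewrite !polygamma_hurwitz, pow_1_even by lra.
  field; split; [apply INR_fact_neq_0|apply pow_nonzero; lra].
Qed.

(** * Logarithmic integrals *)

Lemma ln_nonpos (x : R) : x <= 0 -> ln x = 0.
Proof.
  intros Hx; unfold ln; destruct (Rlt_dec 0 x) as [Hpos|Hpos]; [exfalso; lra|reflexivity].
Qed.

Lemma ln_le_0 (x : R) : x <= 1 -> ln x <= 0.
Proof.
  intros Hx; destruct (Rle_lt_dec x 0) as [Hsign|Hsign]; [rewrite ln_nonpos by assumption; lra|].
  rewrite <- ln_1; now apply ln_le.
Qed.

Lemma mul_ln_pow_sqr_le (x : R) (p : nat) :
  0 < x <= 1 -> (x * ln x ^ p) ^ 2 <= x * INR (fact (p * 2)).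
Proof.
  intros [Hx Hx1].
  assert (Hln := ln_le_0 x Hx1).
  assert (Hexp := pow_div_fact_le_exp (- ln x) (p * 2) ltac:(lra)).
  apply (Rle_div_l _ _ _ (INR_fact_lt_0 (p * 2))) in Hexp.
  rewrite exp_Ropp, exp_ln, (Nat.mul_comm p 2), pow_mult in Hexp by assumption.
  replace ((- ln x) ^ 2) with (ln x ^ 2) in Hexp by ring.
  rewrite <- pow_mult, Nat.mul_comm, pow_mult in Hexp.
  apply Rmult_le_compat_l with (r := x ^ 2) in Hexp; [|apply pow2_ge_0].
  replace (x ^ 2 * (/ x * INR (fact (p * 2)))) with (x * INR (fact (p * 2))) in Hexp
    by (field; lra).
  now rewrite Rpow_mult_distr.
Qed.

Lemma continuous_mul_ln_pow_0 (p : nat) : continuous (fun x => x * ln x ^ p) 0.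
Proof.
  destruct p as [|p].
  { apply continuous_ext with (f := fun x : R => x); [|apply continuous_id].
    intros x; symmetry; apply Rmult_1_r. }
  apply filterlim_locally; intros eps; assert (He := cond_pos eps).
  set (F := INR (fact (S p * 2))).
  assert (HF : 0 < F) by apply INR_fact_lt_0.
  assert (Hd : 0 < Rmin 1 (eps ^ 2 / F)).
  { apply Rmin_glb_lt; [lra|apply Rdiv_lt_0_compat; nra]. }
  exists (mkposreal _ Hd); intros x Hx; apply Rabs_lt_between' in Hx; cbn [pos] in Hx.
  assert (Hx1 := Rmin_l 1 (eps ^ 2 / F)); assert (Hx2 := Rmin_r 1 (eps ^ 2 / F)).
  change (Rabs (x * ln x ^ S p - 0 * ln 0 ^ S p) < eps).
  rewrite Rmult_0_l, Rminus_0_r.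
  destruct (Rle_lt_dec x 0) as [Hsign|Hsign].
  { rewrite ln_nonpos, pow_ne_zero, Rmult_0_r, Rabs_R0 by (assumption || lia); lra. }
  rewrite <- (Rabs_pos_eq eps) by lra.
  apply Rsqr_lt_abs_0; rewrite !Rsqr_pow2.
  apply Rle_lt_trans with (1 := mul_ln_pow_sqr_le x (S p) ltac:(lra)).
  apply (Rlt_div_r _ _ _ HF); lra.
Qed.

Lemma continuous_pow_mul_ln_pow (m p : nat) (x : R) :
  0 <= x -> continuous (fun x => x ^ S m * ln x ^ p) x.
Proof.
  intros [Hx|<-].
  - apply (ex_derive_continuous (fun x => x ^ S m * ln x ^ p)); auto_derive; auto.
  - apply continuous_ext with (f := fun x : R => x ^ m * (x * ln x ^ p)).
    { intros x; simpl; ring. }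
    apply (continuous_mult (fun x => x ^ m)); [|apply continuous_mul_ln_pow_0].
    apply (ex_derive_continuous (fun x => x ^ m)); auto_derive; auto.
Qed.

Definition log_integrand (m p r : nat) (x : R) : R := x ^ m * ln x ^ p / (1 + x ^ 2) ^ r.

Lemma one_plus_sqr_pow_pos (r : nat) (x : R) : 0 < (1 + x ^ 2) ^ r.
Proof. apply pow_lt; nra. Qed.

Lemma continuous_log_integrand (m p r : nat) (x : R) :
  0 <= x -> continuous (log_integrand (S m) p r) x.
Proof.
  intros Hx; apply (continuous_mult (fun x => x ^ S m * ln x ^ p)).
  - now apply continuous_pow_mul_ln_pow.
  - apply (ex_derive_continuous (fun x => / (1 + x ^ 2) ^ r)).
    assert (Hden := one_plus_sqr_pow_pos r x); auto_derive; simpl in *; lra.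
Qed.

Definition log_integral (m p r : nat) : R := RInt (log_integrand m p r) 0 1.

Lemma is_RInt_log_integral (m p r : nat) :
  is_RInt (log_integrand (S m) p r) 0 1 (log_integral (S m) p r).
Proof.
  apply (RInt_correct (V := R_CompleteNormedModule)).
  apply (ex_RInt_continuous (V := R_CompleteNormedModule)).
  intros x Hx; rewrite Rmin_left in Hx by lra; apply continuous_log_integrand; lra.
Qed.

Lemma is_derive_id_mul_0 (g : R -> R) :
  continuous g 0 -> is_derive (fun x => x * g x) 0 (g 0).
Proof.
  intros Hg; apply is_derive_Reals; intros eps Heps.
  destruct (proj1 (filterlim_locally g (g 0)) Hg (mkposreal eps Heps)) as [d Hd].
  exists d; intros h Hh Hhd.
  replace (((0 + h) * g (0 + h) - 0 * g 0) / h - g 0) with (g h - g 0)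
    by (rewrite Rplus_0_l; field; exact Hh).
  apply (Hd h); change (Rabs (h - 0) < d); now rewrite Rminus_0_r.
Qed.

(* For [p = 0] the term in [pred p] vanishes, its coefficient being [INR 0]. *)
Lemma is_derive_log_integrand (m p r : nat) (x : R) :
  0 <= x ->
  is_derive (log_integrand (S (S m)) p r) x
    ((INR (S (S m)) - 2 * INR r) * log_integrand (S m) p r x
     + INR p * log_integrand (S m) (pred p) r x
     + 2 * INR r * log_integrand (S m) p (S r) x).
Proof.
  intros [Hx|<-].
  - assert (Hden := one_plus_sqr_pow_pos r x).
    assert (Epred : INR r * (1 + x ^ 2) ^ pred r = INR r * (1 + x ^ 2) ^ r / (1 + x ^ 2)).
    { destruct r as [|r]; simpl; field; nra. }
    unfold log_integrand; auto_derive; [simpl in *; repeat split; lra|].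
    replace (x * (x * 1)) with (x ^ 2) by ring.
    change (match m with O => 1 | S _ => INR m + 1 end) with (INR (S m)).
    rewrite Epred, (S_INR (S m)), <- (tech_pow_Rmult (1 + x ^ 2)), <- (tech_pow_Rmult x m).
    set (u := (1 + x ^ 2) ^ r) in *.
    field; repeat split; nra.
  - apply is_derive_ext with (f := fun x => x * log_integrand (S m) p r x).
    { intros x; unfold log_integrand, Rdiv; simpl; equation_in_R; ring. }
    replace (_ + _ + _) with (log_integrand (S m) p r 0).
    + apply is_derive_id_mul_0, continuous_log_integrand; lra.
    + unfold log_integrand; rewrite !pow_ne_zero by lia; unfold Rdiv; ring.
Qed.

Lemma log_integral_recurrence (m p r : nat) :
  (INR (S (S m)) - 2 * INR r) * log_integral (S m) p r
     + INR p * log_integral (S m) (pred p) r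
     + 2 * INR r * log_integral (S m) p (S r)
  = 0 ^ p / 2 ^ r.
Proof.
  replace (0 ^ p / 2 ^ r) with (log_integrand (S (S m)) p r 1 - log_integrand (S (S m)) p r 0).
  - eapply is_RInt_eq.
    + apply (is_RInt_plus (V := R_NormedModule));
        [apply (is_RInt_plus (V := R_NormedModule))|];
        apply (is_RInt_scal (V := R_NormedModule)), is_RInt_log_integral.
    + apply is_RInt_primitive; [lra| |]; intros x Hx.
      * apply is_derive_log_integrand; lra.
      * apply (continuous_plus (V := R_NormedModule));
          [apply (continuous_plus (V := R_NormedModule))|];
          apply (continuous_scal_r (V := R_NormedModule)), continuous_log_integrand; lra.
  - unfold log_integrand; rewrite ln_1, pow1, (pow_ne_zero (S (S m))) by lia.
    replace (1 + 1 ^ 2) with 2 by ring; unfold Rdiv; ring.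
Qed.

Lemma log_integral_moment (m p : nat) :
  log_integral (S m) p 0 = (-1) ^ p * INR (fact p) / INR (S (S m)) ^ S p.
Proof.
  assert (Hm : INR (S (S m)) <> 0) by now apply not_0_INR.
  assert (Hrec : forall p, log_integral (S m) p 0
    = (0 ^ p - INR p * log_integral (S m) (pred p) 0) / INR (S (S m))).
  { clear p; intros p; assert (Hrec := log_integral_recurrence m p 0).
    rewrite pow_O, Rdiv_1_r in Hrec; rewrite <- Hrec; simpl (INR 0); field; assumption. }
  induction p as [|p IH]; rewrite Hrec.
  - rewrite pow_1, !pow_O; simpl (INR (fact 0)); simpl (INR 0); field; assumption.
  - simpl (pred _); rewrite IH, fact_simpl, mult_INR, pow_ne_zero by lia.
    rewrite <- !(tech_pow_Rmult _ (S p)), <- (tech_pow_Rmult (-1)).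
    assert (Hpow := pow_nonzero _ (S p) Hm); field; auto.
Qed.

Lemma log_integral_shift (m p : nat) :
  log_integral (S m + 2) p 1 = log_integral (S m) p 0 - log_integral (S m) p 1.
Proof.
  change (S m + 2)%nat with (S (m + 2)).
  eapply is_RInt_eq; [apply is_RInt_log_integral|].
  eapply is_RInt_ext;
    [|apply (is_RInt_minus (V := R_NormedModule)); apply is_RInt_log_integral].
  intros x _.
  change (log_integrand (S m) p 0 x - log_integrand (S m) p 1 x = log_integrand (S m + 2) p 1 x).
  unfold log_integrand; rewrite pow_add, pow_O, pow_1; field; nra.
Qed.

Lemma Rabs_log_integrand_le (m p : nat) (x : R) :
  0 <= x <= 1 -> Rabs (log_integrand m p 1 x) <= (-1) ^ p * log_integrand m p 0 x.
Proof.
  intros Hx; unfold log_integrand, Rdiv; rewrite pow_O, pow_1, Rinv_1, Rmult_1_r.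
  assert (Hln : (-1) ^ p * ln x ^ p = Rabs (ln x) ^ p).
  { rewrite <- Rpow_mult_distr, Rabs_left1 by (apply ln_le_0; lra); f_equal; ring. }
  replace ((-1) ^ p * (x ^ m * ln x ^ p)) with (x ^ m * Rabs (ln x) ^ p)
    by (rewrite <- Hln; ring).
  rewrite !Rabs_mult, <- !RPow_abs, (Rabs_pos_eq x), Rabs_inv by lra.
  rewrite <- (Rmult_1_r (x ^ m * Rabs (ln x) ^ p)) at 2.
  apply Rmult_le_compat_l.
  - apply Rmult_le_pos; apply pow_le; [lra|apply Rabs_pos].
  - rewrite <- Rinv_1; apply Rinv_le_contravar; [lra|].
    apply Rle_trans with (2 := Rle_abs _); nra.
Qed.

Lemma Rabs_log_integral_le (m p : nat) :
  Rabs (log_integral (S m) p 1) <= INR (fact p) / INR (S (S m)).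
Proof.
  assert (Hm : 1 <= INR (S (S m))) by (apply (le_INR 1); lia).
  apply Rle_trans with ((-1) ^ p * log_integral (S m) p 0).
  - apply (norm_RInt_le (V := R_NormedModule) (log_integrand (S m) p 1)
      (fun x => (-1) ^ p * log_integrand (S m) p 0 x) 0 1); [lra| |apply is_RInt_log_integral|].
    + intros x Hx; now apply Rabs_log_integrand_le.
    + apply (is_RInt_scal (V := R_NormedModule)), is_RInt_log_integral.
  - rewrite log_integral_moment; unfold Rdiv.
    rewrite <- !Rmult_assoc, <- Rpow_mult_distr.
    replace (-1 * -1) with 1 by ring; rewrite pow1, Rmult_1_l.
    apply Rmult_le_compat_l; [apply pos_INR|].
    rewrite <- (pow_1 (INR (S (S m)))) at 2.
    apply Rinv_le_contravar; [apply pow_lt; lra|apply Rle_pow; [exact Hm|lia]].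
Qed.

Lemma is_lim_seq_log_integral (m p : nat) : is_lim_seq (fun j => log_integral (S m + 4 * j) p 1) 0.
Proof.
  apply is_lim_seq_abs_0, is_lim_seq_le_le with (u := fun _ => 0)
    (w := fun j => INR (fact p) / INR (S j)).
  - intros j; split; [apply Rabs_pos|].
    apply Rle_trans with (1 := Rabs_log_integral_le (m + 4 * j) p).
    apply Rmult_le_compat_l; [apply pos_INR|].
    apply Rinv_le_contravar; [apply lt_0_INR; lia|apply le_INR; lia].
  - apply is_lim_seq_const.
  - apply is_lim_seq_div_S.
Qed.

Lemma log_integral_moment_quarter (m p j : nat) :
  log_integral (S m + 4 * j) p 0
  = (-1) ^ p * INR (fact p) / 4 ^ S p * / (INR (m + 2) / 4 + INR j) ^ S p.
Proof.
  change (S m + 4 * j)%nat with (S (m + 4 * j)); rewrite log_integral_moment.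
  assert (Hpos : 0 < INR (m + 2) + 4 * INR j).
  { assert (Hm := lt_0_INR (m + 2) ltac:(lia)); assert (Hj := pos_INR j); lra. }
  replace (INR (S (S (m + 4 * j)))) with (INR (m + 2) + 4 * INR j)
    by (rewrite !S_INR, !plus_INR, mult_INR; simpl (INR _); ring).
  replace (INR (m + 2) / 4 + INR j) with ((INR (m + 2) + 4 * INR j) / 4) by field.
  rewrite inv_pow_div; field; split; apply pow_nonzero; lra.
Qed.

(* By [log_integral_shift] applied twice, two consecutive terms of the null sequence
   [log_integral (m + 4 * j) p 1] differ by a difference of moments. *)
Lemma log_integral_hurwitz (m p : nat) :
  (1 <= p)%nat ->
  log_integral (S m) p 1 = (-1) ^ p * INR (fact p) / 4 ^ S p
    * (hurwitz (S p) (INR (m + 2) / 4) - hurwitz (S p) (INR (m + 4) / 4)).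
Proof.
  intros Hp.
  assert (Htel := is_series_telescope _ 0 (is_lim_seq_log_integral m p)); cbv beta in Htel.
  rewrite Nat.mul_0_r, Nat.add_0_r, Rminus_0_r in Htel.
  rewrite <- (is_series_unique _ _ Htel).
  apply is_series_unique.
  apply is_series_ext with (a := fun j => (-1) ^ p * INR (fact p) / 4 ^ S p
    * (/ (INR (m + 2) / 4 + INR j) ^ S p - / (INR (m + 4) / 4 + INR j) ^ S p)).
  - intros j; equation_in_R; rewrite Rmult_minus_distr_l.
    replace (m + 4)%nat with (m + 2 + 2)%nat by lia.
    rewrite <- !log_integral_moment_quarter.
    replace (S m + 4 * S j)%nat with (S (m + 2) + 4 * j + 2)%nat by lia.
    replace (S (m + 2) + 4 * j)%nat with (S m + 4 * j + 2)%nat by lia.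
    change (S m + 4 * j)%nat with (S (m + 4 * j)).
    assert (Hshift := log_integral_shift (m + 4 * j) p).
    assert (Hshift2 := log_integral_shift (m + 4 * j + 2) p).
    change (S (m + 4 * j + 2)) with (S (m + 4 * j) + 2)%nat in Hshift2; lra.
  - apply (is_series_scal (V := R_NormedModule)), (is_series_minus (V := R_NormedModule));
      apply is_series_hurwitz; try lia; apply Rdiv_lt_0_compat; try lra; apply lt_0_INR; lia.
Qed.

Lemma log_integral_1_0_1 : log_integral 1 0 1 = / 2 * ln 2.
Proof.
  eapply is_RInt_eq; [apply is_RInt_log_integral|].
  replace (/ 2 * ln 2) with (/ 2 * ln (1 + 1 ^ 2) - / 2 * ln (1 + 0 ^ 2)).
  - apply (is_RInt_primitive (fun x => / 2 * ln (1 + x ^ 2))); [lra| |]; intros x Hx.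
    + unfold log_integrand; auto_derive; [nra|simpl; field; nra].
    + apply continuous_log_integrand; lra.
  - replace (1 + 1 ^ 2) with 2 by ring; replace (1 + 0 ^ 2) with 1 by ring.
    rewrite ln_1; ring.
Qed.

Lemma log_integral_2_0_1 : log_integral 2 0 1 = 1 - PI / 4.
Proof.
  eapply is_RInt_eq; [apply is_RInt_log_integral|].
  replace (1 - PI / 4) with ((1 - atan 1) - (0 - atan 0))
    by (rewrite atan_1, atan_0; ring).
  apply (is_RInt_primitive (fun x => x - atan x)); [lra| |]; intros x Hx.
  - unfold log_integrand; auto_derive; [exact I|unfold Rsqr; simpl; field; nra].
  - apply continuous_log_integrand; lra.
Qed.

Lemma log_integral_1_zeta (p : nat) :
  (1 <= p)%nat ->
  log_integral 1 p 1 = (-1) ^ p * INR (fact p) / 4 ^ S p * (2 ^ S p - 2) * zeta (INR (p + 1)).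
Proof.
  intros Hp; rewrite log_integral_hurwitz by assumption.
  assert (Hdup := hurwitz_duplication (S p) 1 ltac:(lia) Rlt_0_1).
  rewrite Nat.add_1_r, zeta_hurwitz.
  replace (INR (0 + 2) / 4) with (1 / 2) by (simpl; field).
  replace (INR (0 + 4) / 4) with 1 by (simpl; field).
  replace ((1 + 1) / 2) with 1 in Hdup by field.
  rewrite Rmult_assoc; f_equal; lra.
Qed.

Lemma log_integral_2_dirichlet_beta (p : nat) :
  (1 <= p)%nat ->
  log_integral 2 p 1 = (-1) ^ p * INR (fact p) * (1 - dirichlet_beta (S p)).
Proof.
  intros Hp; rewrite log_integral_hurwitz by assumption; unfold dirichlet_beta.
  rewrite (hurwitz_succ (S p) (1 / 4)), inv_pow_div, pow1 by (lia || lra).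
  replace (INR (1 + 2) / 4) with (3 / 4) by (simpl; field).
  replace (INR (1 + 4) / 4) with (1 / 4 + 1) by (simpl; field).
  field; apply pow_nonzero; lra.
Qed.

(** * Rational linear combinations *)

Record Qsubspace (V : R -> Prop) : Prop := {
  Qsubspace_0 : V 0;
  Qsubspace_plus : forall x y, V x -> V y -> V (x + y);
  Qsubspace_scal : forall a x, rational a -> V x -> V (a * x) }.

Lemma Qsubspace_minus (V : R -> Prop) (x y : R) : Qsubspace V -> V x -> V y -> V (x - y).
Proof.
  intros HV Hx Hy; replace (x - y) with (x + -1 * y) by ring.
  apply (Qsubspace_plus V HV); [exact Hx|].
  apply (Qsubspace_scal V HV); [apply (rational_Z (-1))|exact Hy].
Qed.

Lemma Qsubspace_rational (V : R -> Prop) (a : R) : Qsubspace V -> V 1 -> rational a -> V a.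
Proof. intros HV Hone Ha; rewrite <- (Rmult_1_r a); now apply (Qsubspace_scal V HV). Qed.

Definition Qspan (f : nat -> R) (a b : nat) (x : R) : Prop :=
  exists l : nat -> Q, x = sum_n_m (fun i => Q2R (l i) * f i) a b.

Lemma Qspan_subspace (f : nat -> R) (a b : nat) : Qsubspace (Qspan f a b).
Proof.
  split.
  - exists (fun _ => 0%Q); rewrite <- (Rmult_0_l (sum_n_m f a b)).
    rewrite <- RMicromega.Q2R_0; symmetry; apply (sum_n_m_mult_l (K := R_Ring)).
  - intros x y [l ->] [l' ->]; exists (fun i => l i + l' i)%Q.
    etransitivity; [symmetry; apply (sum_n_m_plus (G := R_AbelianMonoid))|].
    apply sum_n_m_ext; intros i; rewrite Q2R_plus; symmetry; apply Rmult_plus_distr_r.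
  - intros c x [c' ->] [l ->]; exists (fun i => c' * l i)%Q.
    etransitivity; [symmetry; apply (sum_n_m_mult_l (K := R_Ring))|].
    apply sum_n_m_ext; intros i; rewrite Q2R_mult; symmetry; apply Rmult_assoc.
Qed.

Lemma sum_n_m_single (u : nat -> R) (a b i : nat) :
  (a <= i <= b)%nat -> (forall j, (a <= j <= b)%nat -> j <> i -> u j = 0) ->
  sum_n_m u a b = u i.
Proof.
  intros Hi Hu.
  assert (vanish : forall c d, (a <= c)%nat -> (d <= b)%nat -> (i < c \/ d < i)%nat ->
    sum_n_m u c d = 0).
  { intros c d Hc Hd Hcd; transitivity (sum_n_m (fun _ => zero : R_AbelianMonoid) c d).
    - apply sum_n_m_ext_loc; intros j Hj; apply Hu; lia.
    - apply (sum_n_m_const_zero (G := R_AbelianMonoid)). }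
  rewrite (sum_n_m_Chasles u a i b), (vanish (S i)) by lia.
  destruct (Nat.eq_dec a i) as [->|Hai].
  - rewrite sum_n_n; apply Rplus_0_r.
  - destruct i as [|i]; [lia|].
    rewrite sum_n_Sm, vanish by lia; unfold plus; simpl; ring.
Qed.

Lemma Qspan_generator (f : nat -> R) (a b i : nat) : (a <= i <= b)%nat -> Qspan f a b (f i).
Proof.
  intros Hi; exists (fun j => if Nat.eqb i j then 1%Q else 0%Q).
  rewrite (sum_n_m_single _ a b i Hi).
  - now rewrite Nat.eqb_refl, RMicromega.Q2R_1, Rmult_1_l.
  - intros j _ Hj; destruct (Nat.eqb_spec i j); [now subst|].
    rewrite RMicromega.Q2R_0; apply Rmult_0_l.
Qed.

Definition Qsum (V W : R -> Prop) (x : R) : Prop :=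
  exists y z, V y /\ W z /\ x = y + z.

Lemma Qsum_subspace (V W : R -> Prop) : Qsubspace V -> Qsubspace W -> Qsubspace (Qsum V W).
Proof.
  intros HV HW; split.
  - exists 0, 0; split; [|split]; [apply HV|apply HW|ring].
  - intros x x' [y [z [Hy [Hz ->]]]] [y' [z' [Hy' [Hz' ->]]]].
    exists (y + y'), (z + z'); split; [|split]; [now apply HV|now apply HW|ring].
  - intros a x Ha [y [z [Hy [Hz ->]]]].
    exists (a * y), (a * z); split; [|split]; [now apply HV|now apply HW|ring].
Qed.

Lemma Qsum_left (V W : R -> Prop) (x : R) : Qsubspace W -> V x -> Qsum V W x.
Proof. intros HW Hx; exists x, 0; split; [|split]; [exact Hx|apply HW|ring]. Qed.

Lemma Qsum_right (V W : R -> Prop) (x : R) : Qsubspace V -> W x -> Qsum V W x.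
Proof. intros HV Hx; exists 0, x; split; [|split]; [apply HV|exact Hx|ring]. Qed.

(* The sequence [e, g 1, ..., g n, z], indexed from 0 to [n + 1]. *)
Definition bordered (n : nat) (e : R) (g : nat -> R) (z : R) (i : nat) : R :=
  if Nat.eqb i 0 then e else if Nat.leb i n then g i else z.

Lemma bordered_inner (n : nat) (e : R) (g : nat -> R) (z : R) (i : nat) :
  (1 <= i <= n)%nat -> bordered n e g z i = g i.
Proof.
  intros Hi; unfold bordered.
  destruct (Nat.eqb_spec i 0); [lia|]; destruct (Nat.leb_spec i n); [reflexivity|lia].
Qed.

Lemma bordered_last (n : nat) (e : R) (g : nat -> R) (z : R) :
  bordered n e g z (n + 1) = z.
Proof.
  unfold bordered.
  destruct (Nat.eqb_spec (n + 1) 0); [lia|].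
  destruct (Nat.leb_spec (n + 1) n); [lia|reflexivity].
Qed.

Lemma Qspan_bordered_first (n : nat) (e : R) (g : nat -> R) (z : R) :
  Qspan (bordered n e g z) 0 (n + 1) e.
Proof. apply (Qspan_generator (bordered n e g z) 0 (n + 1) 0); lia. Qed.

Lemma Qspan_bordered_inner (n : nat) (e : R) (g : nat -> R) (z : R) (i : nat) :
  (1 <= i <= n)%nat -> Qspan (bordered n e g z) 0 (n + 1) (g i).
Proof.
  intros Hi; rewrite <- (bordered_inner n e g z i Hi); apply Qspan_generator; lia.
Qed.

Lemma Qspan_bordered_last (n : nat) (e : R) (g : nat -> R) (z : R) :
  Qspan (bordered n e g z) 0 (n + 1) z.
Proof.
  generalize (Qspan_generator (bordered n e g z) 0 (n + 1) (n + 1) ltac:(lia)).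
  now rewrite bordered_last.
Qed.

Lemma Qspan_bordered_combination (n : nat) (e : R) (g : nat -> R) (z x : R) :
  Qspan (bordered n e g z) 0 (n + 1) x ->
  exists l : nat -> Q,
    x = Q2R (l 0%nat) * e + sum_n_m (fun i => Q2R (l i) * g i) 1 n + Q2R (l (n + 1)%nat) * z.
Proof.
  intros [l ->]; exists l.
  rewrite sum_Sn_m, Nat.add_1_r, sum_n_Sm, <- (Nat.add_1_r n), bordered_last by lia.
  rewrite (sum_n_m_ext_loc _ (fun i => Q2R (l i) * g i) 1 n)
    by (intros i Hi; now rewrite bordered_inner).
  symmetry; apply Rplus_assoc.
Qed.

(** * The integrals in terms of zeta, pi and polygamma values *)

Lemma Qsubspace_log_integral_shift (V : R -> Prop) (m p i : nat) :
  Qsubspace V -> V 1 -> V (log_integral (S m) p 1) -> V (log_integral (S m + 2 * i) p 1).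
Proof.
  intros HV Hone Hm; induction i as [|i IH]; [now rewrite Nat.mul_0_r, Nat.add_0_r|].
  replace (S m + 2 * S i)%nat with (S (m + 2 * i) + 2)%nat by lia.
  rewrite log_integral_shift; apply Qsubspace_minus; [exact HV| |exact IH].
  rewrite log_integral_moment; apply Qsubspace_rational; auto with rational.
Qed.

Lemma Qsubspace_log_integral_succ (V : R -> Prop) (m pmax r p : nat) :
  Qsubspace V -> V 1 -> (forall p, (p <= pmax)%nat -> V (log_integral (S m) p 1)) ->
  (p <= pmax)%nat -> V (log_integral (S m) p (S r)).
Proof.
  intros HV Hone Hbase; revert p; induction r as [|r IH]; intros p Hp; [now apply Hbase|].
  assert (Hr : INR (S r) <> 0) by now apply not_0_INR.
  replace (log_integral (S m) p (S (S r))) with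
    (/ (2 * INR (S r)) * (0 ^ p / 2 ^ S r
       - (INR (S (S m)) - 2 * INR (S r)) * log_integral (S m) p (S r)
       - INR p * log_integral (S m) (pred p) (S r)))
    by (rewrite <- (log_integral_recurrence m p (S r)); field; assumption).
  apply (Qsubspace_scal V HV); [auto with rational|].
  apply Qsubspace_minus; [exact HV|apply Qsubspace_minus; [exact HV| |]|].
  - apply Qsubspace_rational; auto with rational.
  - apply (Qsubspace_scal V HV); [auto with rational|now apply IH].
  - apply (Qsubspace_scal V HV); [auto with rational|apply IH; lia].
Qed.

Lemma Qsubspace_log_integral (V : R -> Prop) (m pmax r p i : nat) :
  Qsubspace V -> V 1 -> (forall p, (p <= pmax)%nat -> V (log_integral (S m) p 1)) ->
  (p <= pmax)%nat -> (1 <= r)%nat -> V (log_integral (S m + 2 * i) p r).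
Proof.
  intros HV Hone Hbase Hp Hr; destruct r as [|r]; [lia|].
  apply (Qsubspace_log_integral_succ V (m + 2 * i) pmax); auto.
  intros p' Hp'; now apply (Qsubspace_log_integral_shift V m), Hbase.
Qed.

Definition zeta_span (q : nat) : R -> Prop :=
  Qspan (bordered q (ln 2) (fun i => zeta (INR (i + 1))) 1) 0 (q + 1).

Lemma zeta_span_subspace (q : nat) : Qsubspace (zeta_span q).
Proof. apply Qspan_subspace. Qed.

Lemma zeta_span_1 (q : nat) : zeta_span q 1.
Proof. apply Qspan_bordered_last. Qed.

Lemma zeta_span_log_integral (q p : nat) : (p <= q)%nat -> zeta_span q (log_integral 1 p 1).
Proof.
  intros Hp; destruct (Nat.eq_dec p 0) as [->|Hp0].
  - rewrite log_integral_1_0_1.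
    apply (Qsubspace_scal _ (zeta_span_subspace q)); [auto with rational|].
    apply Qspan_bordered_first.
  - rewrite log_integral_1_zeta by lia.
    apply (Qsubspace_scal _ (zeta_span_subspace q)); [auto 10 with rational|].
    apply (Qspan_bordered_inner q _ (fun i => zeta (INR (i + 1)))); lia.
Qed.

Definition beta_span (K k : nat) : R -> Prop :=
  Qsum (Qspan (bordered K catalan (fun i => PI ^ (2 * i - 1)) 1) 0 (K + 1))
       (Qspan polygamma_quarters 2 k).

Lemma beta_span_subspace (K k : nat) : Qsubspace (beta_span K k).
Proof. apply Qsum_subspace; apply Qspan_subspace. Qed.

Lemma beta_span_1 (K k : nat) : beta_span K k 1.
Proof. apply Qsum_left; [apply Qspan_subspace|apply Qspan_bordered_last]. Qed.

Lemma beta_span_catalan (K k : nat) : beta_span K k catalan.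
Proof. apply Qsum_left; [apply Qspan_subspace|apply Qspan_bordered_first]. Qed.

Lemma beta_span_PI (K k i : nat) : (1 <= i <= K)%nat -> beta_span K k (PI ^ (2 * i - 1)).
Proof.
  intros Hi; apply Qsum_left; [apply Qspan_subspace|].
  now apply (Qspan_bordered_inner K _ (fun i => PI ^ (2 * i - 1))).
Qed.

Lemma beta_span_dirichlet_beta (K k s : nat) :
  (2 <= s <= 2 * K)%nat -> (s <= 2 * k + 1)%nat -> beta_span K k (dirichlet_beta s).
Proof.
  intros HsK Hsk; assert (HV := beta_span_subspace K k).
  destruct (Nat.Even_or_Odd s) as [[i ->]|[i ->]].
  - destruct (Nat.eq_dec i 1) as [->|Hi].
    + change (2 * 1)%nat with 2%nat; rewrite <- catalan_dirichlet_beta.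
      apply beta_span_catalan.
    + rewrite dirichlet_beta_even by lia.
      apply (Qsubspace_scal _ HV); [auto with rational|].
      apply Qsum_right; [apply Qspan_subspace|].
      apply (Qspan_generator polygamma_quarters); lia.
  - destruct (dirichlet_beta_odd i ltac:(lia)) as [a [Ha ->]].
    apply (Qsubspace_scal _ HV); [exact Ha|].
    replace (2 * i + 1)%nat with (2 * S i - 1)%nat by lia.
    apply beta_span_PI; lia.
Qed.

Lemma beta_span_log_integral (K k p : nat) :
  (p < 2 * K)%nat -> (p <= 2 * k)%nat -> beta_span K k (log_integral 2 p 1).
Proof.
  intros HpK Hpk; assert (HV := beta_span_subspace K k).
  destruct (Nat.eq_dec p 0) as [->|Hp0].
  - rewrite log_integral_2_0_1; apply Qsubspace_minus; [exact HV|apply beta_span_1|].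
    replace (PI / 4) with (/ 4 * PI ^ (2 * 1 - 1)) by (simpl; field).
    apply (Qsubspace_scal _ HV); [auto with rational|apply beta_span_PI; lia].
  - rewrite log_integral_2_dirichlet_beta by lia.
    apply (Qsubspace_scal _ HV); [auto with rational|].
    apply Qsubspace_minus; [exact HV|apply beta_span_1|].
    apply beta_span_dirichlet_beta; lia.
Qed.

Lemma zeta_span_combination (q : nat) (x : R) :
  zeta_span q x ->
  exists l : nat -> Q,
    x = Q2R (l 0%nat) * ln 2
        + sum_n_m (fun i : nat => Q2R (l i) * zeta (INR (i + 1))) 1 q
        + Q2R (l (q + 1)%nat).
Proof.
  intros Hx; destruct (Qspan_bordered_combination _ _ _ _ _ Hx) as [l ->].
  exists l; now rewrite Rmult_1_r.
Qed.

Lemma beta_span_combination (K k : nat) (x : R) :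
  beta_span K k x ->
  exists l c : nat -> Q,
    x = Q2R (l 0%nat) * catalan
        + sum_n_m (fun i : nat => Q2R (l i) * PI ^ (2 * i - 1)) 1 K
        + sum_n_m (fun j : nat => Q2R (c j) *
            (polygamma (2 * j - 1) (1 / 4) - polygamma (2 * j - 1) (3 / 4))) 2 k
        + Q2R (l (K + 1)%nat).
Proof.
  intros [y [z [Hy [[c ->] ->]]]]; destruct (Qspan_bordered_combination _ _ _ _ _ Hy) as [l ->].
  exists l, c; rewrite Rmult_1_r; unfold polygamma_quarters; ring.
Qed.

Theorem theorem4 (r n q k : nat)
    (hr : (1 <= r)%nat) (hn : (1 <= n)%nat)
    (hq : (1 <= q)%nat) (hk : (1 <= k)%nat) :
  (exists l : nat -> Q,
     is_RInt (fun x : R => x ^ (2 * n - 1) * ln x ^ q / (1 + x ^ 2) ^ r) 0 1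
       (Q2R (l 0%nat) * ln 2
        + sum_n_m (fun i : nat => Q2R (l i) * zeta (INR (i + 1))) 1 q
        + Q2R (l (q + 1)%nat)))
  /\
  (exists l c : nat -> Q,
     is_RInt (fun x : R => x ^ (2 * n) * ln x ^ (2 * k - 1) / (1 + x ^ 2) ^ r) 0 1
       (Q2R (l 0%nat) * catalan
        + sum_n_m (fun i : nat => Q2R (l i) * PI ^ (2 * i - 1)) 1 k
        + sum_n_m (fun j : nat => Q2R (c j) *
            (polygamma (2 * j - 1) (1 / 4) - polygamma (2 * j - 1) (3 / 4))) 2 k
        + Q2R (l (k + 1)%nat)))
  /\
  (exists l c : nat -> Q,
     is_RInt (fun x : R => x ^ (2 * n) * ln x ^ (2 * k) / (1 + x ^ 2) ^ r) 0 1
       (Q2R (l 0%nat) * catalan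
        + sum_n_m (fun i : nat => Q2R (l i) * PI ^ (2 * i - 1)) 1 (k + 1)
        + sum_n_m (fun j : nat => Q2R (c j) *
            (polygamma (2 * j - 1) (1 / 4) - polygamma (2 * j - 1) (3 / 4))) 2 k
        + Q2R (l (k + 2)%nat))).
Proof.
  destruct n as [|n]; [lia|].
  replace (2 * S n - 1)%nat with (1 + 2 * n)%nat by lia.
  replace (2 * S n)%nat with (2 + 2 * n)%nat by lia.
  replace (k + 2)%nat with (k + 1 + 1)%nat by lia.
  assert (Hzeta : zeta_span q (log_integral (1 + 2 * n) q r)).
  { apply (Qsubspace_log_integral _ 0 q);
      auto using zeta_span_subspace, zeta_span_1, zeta_span_log_integral. }
  assert (Hbeta : forall K p, (p < 2 * K)%nat -> (p <= 2 * k)%nat ->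
    beta_span K k (log_integral (2 + 2 * n) p r)).
  { intros K p HpK Hpk; apply (Qsubspace_log_integral _ 1 p);
      auto using beta_span_subspace, beta_span_1.
    intros p' Hp'; apply beta_span_log_integral; lia. }
  split; [|split].
  - destruct (zeta_span_combination _ _ Hzeta) as [l Hl].
    exists l; rewrite <- Hl; apply is_RInt_log_integral.
  - destruct (beta_span_combination k k _ (Hbeta k (2 * k - 1)%nat
      ltac:(lia) ltac:(lia))) as [l [c Hlc]].
    exists l, c; rewrite <- Hlc; apply is_RInt_log_integral.
  - destruct (beta_span_combination (k + 1) k _ (Hbeta (k + 1)%nat (2 * k)%nat
      ltac:(lia) ltac:(lia))) as [l [c Hlc]].
    exists l, c; rewrite <- Hlc; apply is_RInt_log_integral.
Qed.
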